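(* Assume $\cos(\varphi_{GU})>0$. Then the oblique projection $\mathcal{P}_{G\,P_U(G)^\perp}$ with range $G$ and kernel $P_U(G)^\perp$ exists as a bounded operator on $H$, the operator $(\mathcal{U}^*\mathcal{U})^{\dagger/2}\mathcal{U}^*\mathcal{G}$ has closed range (so its pseudoinverse exists), and $$\mathcal{G}\big((\mathcal{U}^*\mathcal{U})^{\dagger/2}\mathcal{U}^*\mathcal{G}\big)^\dagger(\mathcal{U}^*\mathcal{U})^{\dagger/2}\mathcal{U}^* = \mathcal{P}_{G\,P_U(G)^\perp}.$$ Equivalently, for every $f\in H$, $\mathcal{P}_{G\,P_U(G)^\perp}f=\mathcal{G}\hat c$, where $\hat c$ is the element of minimal norm in the set $\operatorname{arg\,min}_{c\in\ell^2(\mathbb{N})}\|(\mathcal{U}^*\mathcal{U})^{\dagger/2}\mathcal{U}^*f-(\mathcal{U}^*\mathcal{U})^{\dagger/2}\mathcal{U}^*\mathcal{G}c\|$.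
   Context: $H$ is a separable Hilbert space. $\{u_j\}_{j\in\mathbb{N}}$ is a frame sequence in $H$: with $U:=\overline{\operatorname{span}}\{u_j\}$ there are $A,B>0$ with $A\|f\|^2\le\sum_j|\langle f,u_j\rangle|^2\le B\|f\|^2$ for all $f\in U$. Similarly $\{g_k\}_{k\in\mathbb{N}}$ is a frame sequence with $G:=\overline{\operatorname{span}}\{g_k\}$ and bounds $C,D>0$. $\mathcal{U}:\ell^2(\mathbb{N})\to H$, $\mathcal{U}c=\sum_j c_ju_j$ is the synthesis operator, $\mathcal{U}^*f=(\langle f,u_j\rangle)_j$ the analysis operator; $\mathcal{G}$ is the synthesis operator of $\{g_k\}$. $P_W$ denotes the orthogonal projection onto a closed subspace $W$, and $P_U(G)=\{P_Ug:g\in G\}$. For closed subspaces $S,W$, $\cos(\varphi_{SW}):=\inf_{s\in S,\|s\|=1}\|P_Ws\|$. For a bounded operator $T$ with closed range, $T^\dagger$ is the Moore–Penrose pseudoinverse: the unique bounded operator with $\mathcal{N}(T^\dagger)=\mathcal{R}(T)^\perp$, $\mathcal{R}(T^\dagger)=\mathcal{N}(T)^\perp$, $TT^\dagger x=x$ for $x\in\mathcal{R}(T)$. $(\mathcal{U}^*\mathcal{U})^\dagger$ exists and is positive, and $(\mathcal{U}^*\mathcal{U})^{\dagger/2}$ denotes its unique positive square root. For closed subspaces $S,W$ with $S\cap W=\{0\}$ and $S\oplus W=H$, $\mathcal{P}_{SW}$ is the (oblique) projection with range $S$ and kernel $W$. *)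

(* Defs.v *)
(* Scalars: the complex numbers R[i] over an arbitrary R : realType. *)
From Stdlib Require Import ClassicalEpsilon.
From mathcomp Require Import all_boot all_algebra all_classical all_reals.
From mathcomp Require Import complex.
Set Implicit Arguments. Unset Strict Implicit. Unset Printing Implicit Defensive.
Import GRing.Theory Num.Theory.
Local Open Scope ring_scope.

(* A (candidate) inner-product space: a C-vector space [vec], a subspace
   [mem] of it which is the actual space, and a form [inp]. *)
Record space (R : realType) := Space {
  vec : lmodType R[i];
  mem : vec -> Prop;
  inp : vec -> vec -> R[i] }.
Arguments vec {R} s.
Arguments mem {R} s.
Arguments inp {R} s.

Section Spaces.
Variable R : realType.
Local Notation C := R[i].

(* convergence of a scalar sequence *)
Definition cvgC (s : nat -> C) (a : C) : Prop :=
  forall e : C, 0 < e -> exists N, forall n, (N <= n)%N -> `|s n - a| < e.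

Section OneSpace.
Variable E : space R.
Local Notation V := (vec E).

Definition hnorm (x : V) : C := sqrtC (inp E x x).

Definition cvg_to (s : nat -> V) (x : V) : Prop :=
  forall e : C, 0 < e -> exists N, forall n, (N <= n)%N -> hnorm (s n - x) < e.

Definition cauchy (s : nat -> V) : Prop :=
  forall e : C, 0 < e -> exists N, forall m n, (N <= m)%N -> (N <= n)%N ->
    hnorm (s m - s n) < e.

(* inner product axioms (linear in the first variable) on the subspace mem E *)
Definition is_inner_product_space : Prop :=
  [/\ mem E 0,
      (forall (a : C) x y, mem E x -> mem E y -> mem E (a *: x + y)),
      (forall (a : C) x y z, mem E x -> mem E y -> mem E z ->
          inp E (a *: x + y) z = a * inp E x z + inp E y z),
      (forall x y, mem E x -> mem E y -> inp E x y = (inp E y x)^*) &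
      (forall x, mem E x -> 0 <= inp E x x /\ (inp E x x = 0 -> x = 0))].

Definition is_complete : Prop :=
  forall s, (forall n, mem E (s n)) -> cauchy s -> exists x, mem E x /\ cvg_to s x.

Definition is_hilbert : Prop := is_inner_product_space /\ is_complete.

Definition is_separable : Prop :=
  exists d : nat -> V, (forall n, mem E (d n)) /\
    forall x, mem E x -> forall e : C, 0 < e -> exists n, hnorm (x - d n) < e.

(* closed subspaces *)
Definition is_closed (S : V -> Prop) : Prop :=
  forall s x, (forall n, S (s n)) -> mem E x -> cvg_to s x -> S x.

Definition is_subspace (S : V -> Prop) : Prop :=
  [/\ forall x, S x -> mem E x, S 0 &
      forall (a : C) x y, S x -> S y -> S (a *: x + y)].

Definition is_closed_subspace (S : V -> Prop) : Prop :=
  is_subspace S /\ is_closed S.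

(* orthogonal complement (inside the space) *)
Definition perp (S : V -> Prop) : V -> Prop :=
  fun y => mem E y /\ forall x, S x -> inp E y x = 0.

(* p = P_W x : the orthogonal projection of x onto the closed subspace W *)
Definition is_orth_proj_pt (W : V -> Prop) (x p : V) : Prop :=
  W p /\ forall w, W w -> inp E (x - p) w = 0.

(* closed linear span of a family *)
Definition cspan (u : nat -> V) : V -> Prop :=
  fun x => mem E x /\ forall e : C, 0 < e ->
    exists (n : nat) (a : nat -> C), hnorm (x - \sum_(j < n) a j *: u j) < e.

(* frame sequence with bounds A, B :
   A ||f||^2 <= sum_j |<f,u_j>|^2 <= B ||f||^2 for f in closed span *)
Definition is_frame_sequence (u : nat -> V) (A B : C) : Prop :=
  [/\ forall j, mem E (u j), 0 < A, 0 < B &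
      forall f, cspan u f -> exists s : C,
        cvgC (fun n => \sum_(j < n) `|inp E f (u j)| ^+ 2) s /\
        A * inp E f f <= s /\ s <= B * inp E f f].

(* cos(phi_{S W}) > 0, i.e. inf_{s in S, ||s|| = 1} ||P_W s|| > 0 *)
Definition cos_angle_pos (S W : V -> Prop) : Prop :=
  exists c : C, 0 < c /\
    forall s p, S s -> hnorm s = 1 -> is_orth_proj_pt W s p -> c <= hnorm p.

End OneSpace.

Section TwoSpaces.
Variables E F : space R.

(* bounded linear operator from (the space of) E to (the space of) F *)
Definition is_bounded_op (T : vec E -> vec F) : Prop :=
  [/\ forall x, mem E x -> mem F (T x),
      forall (a : R[i]) x y, mem E x -> mem E y -> T (a *: x + y) = a *: T x + T y &
      exists M : R[i], forall x, mem E x -> hnorm (T x) <= M * hnorm x].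

Definition range (T : vec E -> vec F) : vec F -> Prop :=
  fun y => exists x, mem E x /\ y = T x.

Definition kernel (T : vec E -> vec F) : vec E -> Prop :=
  fun x => mem E x /\ T x = 0.

Definition has_closed_range (T : vec E -> vec F) : Prop := is_closed (range T).

End TwoSpaces.

(* Moore--Penrose pseudoinverse Td of T, as defined in the paper *)
Definition is_pseudoinverse (E F : space R) (T : vec E -> vec F) (Td : vec F -> vec E) : Prop :=
  [/\ is_bounded_op Td,
      forall y, kernel Td y <-> perp (range T) y,
      forall x, range Td x <-> perp (kernel T) x &
      forall y, range T y -> T (Td y) = y].


(* positive operator on a space *)
Definition is_positive_op (E : space R) (T : vec E -> vec E) : Prop :=
  is_bounded_op T /\ forall x, mem E x -> 0 <= inp E (T x) x.

(* oblique projection with range S and kernel W *)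
Definition is_oblique_proj (E : space R) (S W : vec E -> Prop)
    (P : vec E -> vec E) : Prop :=
  [/\ is_bounded_op P,
      forall x, mem E x -> P (P x) = P x,
      forall y, range P y <-> S y &
      forall x, kernel P x <-> W x].

(* The sequence space l^2(N) *)
Definition is_l2 (c : nat -> R[i]) : Prop :=
  exists B : R[i], forall n, \sum_(j < n) `|c j| ^+ 2 <= B.

Definition l2inp (c d : nat -> R[i]) : R[i] :=
  epsilon (inhabits 0) (cvgC (fun n => \sum_(j < n) c j * (d j)^*)).

Definition l2space : space R := @Space R (nat -> R[i] : lmodType R[i]) is_l2 l2inp.

(* The Hilbert space H = (V, <.,.>) as a space (the whole of V) *)
Definition full_space (V : lmodType R[i]) (ip : V -> V -> R[i]) : space R :=
  @Space R V (fun _ => True) ip.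

(* synthesis operator: Uop c = sum_j c_j u_j for every c in l^2 *)
Definition is_synthesis (E : space R) (u : nat -> vec E)
    (Uop : vec l2space -> vec E) : Prop :=
  forall c, is_l2 c -> cvg_to (fun n => \sum_(j < n) c j *: u j) (Uop c).

(* analysis operator: f |-> (<f, u_j>)_j *)
Definition analysis (E : space R) (u : nat -> vec E) : vec E -> vec l2space :=
  fun f => (fun j => inp E f (u j)).

(* c is the minimal-norm element of argmin_c || y - T c || *)
Definition is_min_norm_lsq (T : vec l2space -> vec l2space) (y c : vec l2space)
  : Prop :=
  [/\ is_l2 c,
      (forall d : vec l2space, is_l2 d -> hnorm (y - T c) <= hnorm (y - T d)) &
      (forall d : vec l2space, is_l2 d -> (forall d' : vec l2space, is_l2 d' -> hnorm (y - T d) <= hnorm (y - T d')) ->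
         hnorm c <= hnorm d)].

End Spaces.

(* Main.v *)
Require Import Defs.
From mathcomp Require Import all_boot all_order all_algebra all_classical all_reals.
From mathcomp Require Import complex ring lra.
From Stdlib Require ClassicalEpsilon.
(* Restores [mem], [range], [space] and [cvg_to], shadowed by MathComp. *)
Import Defs.
Set Implicit Arguments. Unset Strict Implicit. Unset Printing Implicit Defensive.
Import Order.TTheory GRing.Theory Num.Theory Normc.
Local Open Scope ring_scope.
Local Notation "x %:C" := (real_complex _ x) (format "x %:C") : ring_scope.

(** Put [Q = (U^* U)^{dagger/2} U^*]. On finite combinations of the [u j] one has
    [U (U^* U)^dagger U^* f = f], and continuity extends this to the closed span, so
    [<Q f, Q h> = <P_U f, h>]: [Q] is a partial isometry, bounded below on the span
    of [g] because the angle is positive. Hence [P_U(G)^perp] is the set of [f] with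
    [Q f] orthogonal to [Q(G)], and the oblique projection [P f] is the [x] in [G] with
    [Q x] closest to [Q f]. If [K] is the minimal-norm right inverse of the synthesis
    operator of [g], obtained by inverting the frame operator, then [K P U
    (U^* U)^{dagger/2}] is the pseudoinverse of [Q G]; its continuity gives the closed
    range. All existence claims reduce to one Riesz-type theorem for forms
    [<J h, J x>] with [J] bounded below on a closed subspace of the Hilbert space;
    completeness of [l^2] is never needed. *)

(** * Moduli and convergence of complex numbers, with real tolerances *)

Section ComplexModulus.
Variable R : realType.
Implicit Types z w : R[i].

Lemma normCE z : `|z| = (normc z)%:C. Proof. by []. Qed.
Lemma normc_ge0 z : 0 <= normc z. Proof. by case: z => a b; apply: sqrtr_ge0. Qed.
Lemma normc_add z w : normc (z + w) <= normc z + normc w.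
Proof. by have := ler_normD z w; rewrite !normCE -rmorphD /= lecR. Qed.
Lemma normc_opp z : normc (- z) = normc z.
Proof. by case: z => a b; rewrite /= !sqrrN. Qed.
Lemma normc_conj z : normc z^* = normc z.
Proof. by case: z => a b; rewrite /= sqrrN. Qed.
Lemma normc_real (x : R) : normc x%:C = `|x|.
Proof. by rewrite /= expr0n addr0 sqrtr_sqr. Qed.
Lemma normc_sqrE z : z * z^* = (normc z ^+ 2)%:C.
Proof. by rewrite -normCK normCE rmorphXn. Qed.
Lemma Re_le_normc z : complex.Re z <= normc z.
Proof.
case: z => a b /=; apply: le_trans (ler_norm a) _.
by rewrite -sqrtr_sqr ler_wsqrtr // lerDl sqr_ge0.
Qed.
Lemma cReD z w : complex.Re (z + w) = complex.Re z + complex.Re w.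
Proof. by case: z w => [a b] [c d]. Qed.
Lemma cReN z : complex.Re (- z) = - complex.Re z.
Proof. by case: z => [a b]. Qed.
Lemma cReJ z : complex.Re z^* = complex.Re z.
Proof. by case: z => [a b]. Qed.
Lemma cReM (x : R) z : complex.Re (x%:C * z) = x * complex.Re z.
Proof. by case: z => [a b] /=; ring. Qed.

(** Discriminant bound for a nonnegative quadratic in a complex variable. It yields both
    Cauchy-Schwarz and the residual estimate at an approximate minimiser. *)
Lemma quad_disc z (a b : R) : 0 <= b ->
  (forall t : R[i], 0 <= a + 2 * complex.Re (t * z) + normc t ^+ 2 * b) ->
  normc z ^+ 2 <= a * b.
Proof.
move=> b0 h; set m := normc z ^+ 2.
have m0 : 0 <= m by apply: sqr_ge0.
(* Choosing [t] along [- z^*] makes [t * z] real and negative for [s > 0], which leaves a real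
   quadratic in [s]. *)
have hs (s : R) : 0 <= a - 2 * s * m + s ^+ 2 * m * b.
  have := h (- (s%:C * z^*)).
  rewrite mulNr cReN -[_ * _ * z]mulrA cReM [_ * z]mulrC.
  rewrite normc_sqrE /= normc_opp normcM normc_real normc_conj exprMn real_normK ?num_real //.
  by rewrite -/m mulrN mulrA.
have a0 : 0 <= a by have := hs 0; rewrite expr0n /=; lra.
move: b0; rewrite le_eqVlt => /orP[/eqP b0|b0].
  case: (ltP 0 m) => [m1|]; last by rewrite -b0 mulr0.
  (* With [b = 0] the expression is affine in [s], and this [s] gives it the value [- a - 2 < 0]. *)
  have := hs ((a + 1) / m); rewrite -b0 mulr0 addr0 -mulrA mulfVK ?gt_eqF //.
  lra.
(* The real quadratic is smallest at [s = b^-1]. *)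
have := hs b^-1.
have -> : a - 2 * b^-1 * m + b^-1 ^+ 2 * m * b = (a * b - m) / b by field; rewrite gt_eqF.
by rewrite pmulr_lge0 ?invr_gt0 // subr_ge0.
Qed.

Lemma le0_of_lt_eps (x : R) : (forall e, 0 < e -> x < e) -> x <= 0.
Proof. by move=> h; rewrite leNgt; apply/negP => /h; rewrite ltxx. Qed.

Lemma cvgCP (s : nat -> R[i]) a : cvgC s a <->
  (forall e : R, 0 < e -> exists N, forall n, (N <= n)%N -> normc (s n - a) < e).
Proof.
split=> h e e0.
  have [|N hN] := h e%:C; first by rewrite ltcR.
  by exists N => n /hN; rewrite normCE ltcR.
(* A positive element of [R[i]] has zero imaginary part, so complex tolerances are real ones in
   disguise. *)
have e1 : e = (complex.Re e)%:C by rewrite [LHS]complexE ger0_Im ?ltW // mulr0 addr0.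
rewrite e1 ltcR in e0; have [N hN] := h _ e0.
by exists N => n /hN; rewrite e1 normCE ltcR.
Qed.

Lemma cvgC_lin (k : R[i]) s t a b : cvgC s a -> cvgC t b ->
  cvgC (fun n => k * s n + t n) (k * a + b).
Proof.
move=> /cvgCP hs /cvgCP ht; apply/cvgCP => e e0.
have k0 := normc_ge0 k.
have [|N hN] := hs (e / 2 / (normc k + 1)); first by rewrite !divr_gt0 //; lra.
have [|M hM] := ht (e / 2); first by lra.
exists (maxn N M) => n; rewrite geq_max => /andP[/hN h1 /hM h2].
have -> : k * s n + t n - (k * a + b) = k * (s n - a) + (t n - b) by ring.
apply: le_lt_trans (normc_add _ _) _; rewrite normcM.
move: h1; rewrite ltr_pdivlMr; last by lra.
have := normc_ge0 (s n - a); nra.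
Qed.

Lemma cvgC_conj (s : nat -> R[i]) a : cvgC s a -> cvgC (fun n => (s n)^*) a^*.
Proof.
move=> /cvgCP h; apply/cvgCP => e /h[N hN]; exists N => n /hN.
by rewrite -rmorphB normc_conj.
Qed.

Lemma cvgC_cst (a : R[i]) : cvgC (fun=> a) a.
Proof. by apply/cvgCP => e e0; exists 0%N => n _; rewrite subrr normc0. Qed.

Lemma cvgC_ext (s t : nat -> R[i]) a : (forall n, s n = t n) -> cvgC s a -> cvgC t a.
Proof. by move=> /funext ->. Qed.

Lemma cvgC_uniq (s : nat -> R[i]) a b : cvgC s a -> cvgC s b -> a = b.
Proof.
move=> /cvgCP ha /cvgCP hb; apply/subr0_eq/eq0_normc/le_anti.
rewrite normc_ge0 andbT; apply: le0_of_lt_eps => e e0.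
have [|N hN] := ha (e / 2); first by lra.
have [|M hM] := hb (e / 2); first by lra.
have := hN _ (leq_maxl N M); have := hM _ (leq_maxr N M).
have -> : a - b = (s (maxn N M) - b) - (s (maxn N M) - a) by ring.
have := normc_add (s (maxn N M) - b) (- (s (maxn N M) - a)); rewrite normc_opp; lra.
Qed.

(** The limit is the supremum of the partial sums, which increase. *)
Lemma nonneg_series_cvg (f : nat -> R) (b : R) : (forall j, 0 <= f j) ->
  (forall n, \sum_(j < n) f j <= b) ->
  exists l : R, [/\ cvgC (fun n => (\sum_(j < n) f j)%:C) l%:C,
    (forall n, \sum_(j < n) f j <= l) & l <= b].
Proof.
move=> f0 fb; pose A := [set x : R | exists n, x = \sum_(j < n) f j]%classic.
have hA : has_sup A by split; [exists 0, 0%N; rewrite big_ord0 | exists b => _ [n ->]].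
have ub n : \sum_(j < n) f j <= sup A by apply: sup_upper_bound => //; exists n.
exists (sup A); split => //; last by apply: ge_sup; [case: hA | move=> _ [n ->]].
apply/cvgCP => e e0; have [_ [N ->] hN] := sup_adherent e0 hA.
exists N => n Nn; have -> (x y : R) : x%:C - y%:C = (x - y)%:C by rewrite rmorphB.
rewrite normc_real distrC ger0_norm ?subr_ge0 //.
have : \sum_(j < N) f j <= \sum_(j < n) f j.
  rewrite (big_ord_widen n f Nn) [leRHS](bigID (fun i : 'I_n => (i < N)%N)) /=.
  by rewrite lerDl sumr_ge0.
lra.
Qed.

End ComplexModulus.

(** Norm with values in [R], where the order is total and linear arithmetic applies. On members of
    the space it carries the same information as [hnorm]. *)
Definition nr (R : realType) (E : space R) (x : vec E) : R := complex.Re (hnorm x).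

(** * Linear closure of the carrier predicate *)

Section MemLemmas.
Variables (R : realType) (E : space R).
Hypothesis hE : is_inner_product_space E.
Local Notation mem := (Defs.mem E).

Lemma mem0 : mem 0. Proof. by case: hE. Qed.
Lemma memZD a x y : mem x -> mem y -> mem (a *: x + y).
Proof. by case: hE => _ h _ _ _; apply: h. Qed.
Lemma memZ a x : mem x -> mem (a *: x).
Proof. by move=> hx; rewrite -[_ *: _]addr0; apply: memZD => //; apply: mem0. Qed.
Lemma memD x y : mem x -> mem y -> mem (x + y).
Proof. by move=> hx hy; rewrite -[x]scale1r; apply: memZD. Qed.
Lemma memN x : mem x -> mem (- x).
Proof. by move=> hx; rewrite -scaleN1r; apply: memZ. Qed.
Lemma memB x y : mem x -> mem y -> mem (x - y).
Proof. by move=> hx hy; apply: memD => //; apply: memN. Qed.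
Lemma mem_sum n (a : nat -> R[i]) (x : nat -> vec E) :
  (forall j, mem (x j)) -> mem (\sum_(j < n) a j *: x j).
Proof.
move=> hx; apply: big_ind => [|y z|j _]; [exact: mem0|exact: memD|exact: memZ].
Qed.
End MemLemmas.

(** The inner product laws hold only on [mem E], so nearly every rewrite leaves membership goals of
    this shape. *)
Ltac ms := solve [repeat first [ assumption | exact I
  | lazymatch goal with
    | |- Defs.mem _ (Algebra.add _ _) => eapply memD; [eassumption| |]
    | |- Defs.mem _ (Algebra.opp _) => eapply memN; [eassumption|]
    | |- Defs.mem _ (GRing.scale _ _) => eapply memZ; [eassumption|]
    | |- Defs.mem _ Algebra.zero => eapply mem0; [eassumption]
    | |- _ => solve [eauto]
    end ] ].

(** * Sesquilinear algebra, Cauchy-Schwarz and limits in an inner product space *)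

Section InnerProduct.
Variables (R : realType) (E : space R).
Hypothesis hE : is_inner_product_space E.
Local Notation mem := (Defs.mem E).
Local Notation "<< x , y >>" := (inp E x y).

Lemma inpZDl a x y z : mem x -> mem y -> mem z ->
  << a *: x + y, z >> = a * << x, z >> + << y, z >>.
Proof. by case: hE => _ _ h _ _; apply: h. Qed.
Lemma inpC x y : mem x -> mem y -> << x, y >> = << y, x >>^*.
Proof. by case: hE => _ _ _ h _; apply: h. Qed.
Lemma inp0l z : mem z -> << 0, z >> = 0.
Proof.
move=> hz; have := @inpZDl 1 0 0 z; rewrite scaler0 addr0 mul1r => h.
have /eqP := h ltac:(ms) ltac:(ms) hz.
by rewrite eq_sym -subr_eq0 addrK => /eqP.
Qed.
Lemma inpZl a x z : mem x -> mem z -> << a *: x, z >> = a * << x, z >>.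
Proof.
by move=> hx hz; rewrite -[a *: x]addr0 inpZDl ?inp0l ?addr0 //; ms.
Qed.
Lemma inpDl x y z : mem x -> mem y -> mem z -> << x + y, z >> = << x, z >> + << y, z >>.
Proof. by move=> hx hy hz; rewrite -{1}[x]scale1r inpZDl // mul1r. Qed.
Lemma inpNl x z : mem x -> mem z -> << - x, z >> = - << x, z >>.
Proof. by move=> hx hz; rewrite -scaleN1r inpZl // mulN1r. Qed.
Lemma inpBl x y z : mem x -> mem y -> mem z -> << x - y, z >> = << x, z >> - << y, z >>.
Proof. by move=> hx hy hz; rewrite inpDl ?inpNl //; ms. Qed.
Lemma inp0r z : mem z -> << z, 0 >> = 0.
Proof. by move=> hz; rewrite inpC ?inp0l ?rmorph0 //; ms. Qed.
Lemma inpZr a x z : mem x -> mem z -> << z, a *: x >> = a^* * << z, x >>.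
Proof. by move=> hx hz; rewrite inpC ?inpZl ?rmorphM ?[<< z, x >>]inpC //; ms. Qed.
Lemma inpDr x y z : mem x -> mem y -> mem z -> << z, x + y >> = << z, x >> + << z, y >>.
Proof. by move=> hx hy hz; rewrite inpC ?inpDl ?rmorphD ?[<< z, x >>]inpC ?[<< z, y >>]inpC //; ms. Qed.
Lemma inpNr x z : mem x -> mem z -> << z, - x >> = - << z, x >>.
Proof. by move=> hx hz; rewrite inpC ?inpNl ?rmorphN ?[<< z, x >>]inpC //; ms. Qed.
Lemma inpBr x y z : mem x -> mem y -> mem z -> << z, x - y >> = << z, x >> - << z, y >>.
Proof. by move=> hx hy hz; rewrite inpDr ?inpNr //; ms. Qed.

Lemma inp_suml n (a : nat -> R[i]) (x : nat -> vec E) z : (forall j, mem (x j)) -> mem z ->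
  << \sum_(j < n) a j *: x j, z >> = \sum_(j < n) a j * << x j, z >>.
Proof.
move=> hx hz; elim: n => [|n IH]; first by rewrite !big_ord0 inp0l.
rewrite !big_ord_recr /= inpDl ?IH ?inpZl //; first exact: mem_sum.
by apply: memZ.
Qed.

Lemma hnormE x : mem x -> hnorm x = (nr x)%:C.
Proof.
case: hE => _ _ _ _ h /h[h0 _].
have h1 : 0 <= hnorm x by rewrite sqrtC_ge0.
by rewrite [LHS]complexE (ger0_Im h1) mulr0 addr0.
Qed.
Lemma nr_ge0 x : mem x -> 0 <= nr x.
Proof.
move=> hx; rewrite -lecR -hnormE //.
by case: hE => _ _ _ _ /(_ _ hx)[h _]; rewrite sqrtC_ge0.
Qed.
Lemma inp_self x : mem x -> << x, x >> = (nr x ^+ 2)%:C.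
Proof. by move=> hx; rewrite rmorphXn /= -hnormE // sqrtCK. Qed.
Lemma Re_inp_self x : mem x -> complex.Re << x, x >> = nr x ^+ 2.
Proof. by move=> /inp_self ->. Qed.
Lemma nr0_eq0 x : mem x -> nr x = 0 -> x = 0.
Proof.
move=> hx h0; case: hE => _ _ _ _ /(_ _ hx)[_]; apply.
by rewrite inp_self // h0 expr0n.
Qed.
Lemma nr0 : nr (0 : vec E) = 0.
Proof.
by apply/eqP; rewrite -sqrf_eq0 -Re_inp_self ?inp0l //=; ms.
Qed.
Lemma inp_self0 x : mem x -> << x, x >> = 0 -> x = 0.
Proof. by case: hE => _ _ _ _ h /h[]. Qed.

Lemma nr_sqrD x y : mem x -> mem y ->
  nr (x + y) ^+ 2 = nr x ^+ 2 + nr y ^+ 2 + 2 * complex.Re << x, y >>.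
Proof.
move=> hx hy; rewrite -!Re_inp_self; try ms.
rewrite inpDl ?inpDr ?[<< y, x >>]inpC //; try ms.
rewrite !cReD cReJ; ring.
Qed.
Lemma nrZ a x : mem x -> nr (a *: x) = normc a * nr x.
Proof.
move=> hx; apply/eqP.
rewrite -(@eqrXn2 _ 2) ?mulr_ge0 ?normc_ge0 ?nr_ge0 //; try ms.
rewrite exprMn -!Re_inp_self; try ms.
rewrite inpZl ?inpZr //; try ms; rewrite mulrA.
by rewrite normc_sqrE cReM Re_inp_self.
Qed.
Lemma nrN x : mem x -> nr (- x) = nr x.
Proof. by move=> hx; rewrite -scaleN1r nrZ // normc_opp normc1 mul1r. Qed.
Lemma nr_sub x y : mem x -> mem y -> nr (x - y) = nr (y - x).
Proof. by move=> hx hy; rewrite -nrN ?opprB //; ms. Qed.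

Lemma nr_sqrDZ x y t : mem x -> mem y ->
  nr (x + t *: y) ^+ 2 = nr x ^+ 2 + 2 * complex.Re (t * << y, x >>) + normc t ^+ 2 * nr y ^+ 2.
Proof.
move=> hx hy; rewrite nr_sqrD ?nrZ ?exprMn; try ms.
rewrite [<< x, _ >>]inpC ?inpZl ?cReJ //; try ms.
by rewrite addrAC.
Qed.

Lemma cauchy_schwarz x y : mem x -> mem y -> normc << x, y >> <= nr x * nr y.
Proof.
move=> hx hy; have h0 := nr_ge0 hx; have h1 := nr_ge0 hy.
rewrite -(@ler_pXn2r _ 2) ?nnegrE ?normc_ge0 ?mulr_ge0 // exprMn mulrC.
rewrite mulrC inpC // normc_conj; apply: quad_disc => [|t]; first exact: sqr_ge0.
by rewrite -nr_sqrDZ ?sqr_ge0.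
Qed.

(** The hypothesis says that [x - y] is orthogonal to [x]. This is how projections are seen to be
    contractions. *)
Lemma nr_le_of_inp x y : mem x -> mem y -> << x, x >> = << x, y >> -> nr x <= nr y.
Proof.
move=> hx hy e; have [x0 y0] := (nr_ge0 hx, nr_ge0 hy).
have [xp|] := ltP 0 (nr x); last by lra.
rewrite -(ler_pM2l xp) -expr2; have := cauchy_schwarz hx hy.
by rewrite -e inp_self // normc_real ger0_norm ?sqr_ge0.
Qed.

Lemma nrD x y : mem x -> mem y -> nr (x + y) <= nr x + nr y.
Proof.
move=> hx hy; have h0 := nr_ge0 hx; have h1 := nr_ge0 hy.
rewrite -(@ler_pXn2r _ 2) ?nnegrE ?addr_ge0 ?nr_ge0 //; try ms.
rewrite nr_sqrD //; have := Re_le_normc << x, y >>; have := cauchy_schwarz hx hy; nra.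
Qed.
Lemma nrB_le x y z : mem x -> mem y -> mem z -> nr (x - z) <= nr (x - y) + nr (y - z).
Proof.
by move=> hx hy hz; apply: le_trans (nrD _ _); [rewrite addrA subrK | ms | ms].
Qed.

Lemma cvg_toP (s : nat -> vec E) x : (forall n, mem (s n)) -> mem x -> cvg_to s x <->
  forall e : R, 0 < e -> exists N, forall n, (N <= n)%N -> nr (s n - x) < e.
Proof.
move=> hs hx; split=> h e e0.
  have [|N hN] := h e%:C; first by rewrite ltcR.
  by exists N => n /hN; rewrite hnormE ?ltcR //; apply: memB.
have e1 : e = (complex.Re e)%:C by rewrite [LHS]complexE ger0_Im ?ltW // mulr0 addr0.
rewrite e1 ltcR in e0; have [N hN] := h _ e0.
by exists N => n /hN; rewrite e1 hnormE ?ltcR //; apply: memB.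
Qed.

Lemma cvg_to_uniq (s : nat -> vec E) x y : (forall n, mem (s n)) -> mem x -> mem y ->
  cvg_to s x -> cvg_to s y -> x = y.
Proof.
move=> hs hx hy /(cvg_toP hs hx) sx /(cvg_toP hs hy) sy.
apply/subr0_eq/nr0_eq0; first ms; apply/le_anti.
rewrite nr_ge0 ?andbT; last ms; apply: le0_of_lt_eps => e e0.
have [|N hN] := sx (e / 2); first by lra.
have [|M hM] := sy (e / 2); first by lra.
have := hN _ (leq_maxl N M); have := hM _ (leq_maxr N M).
have := nrB_le hx (hs (maxn N M)) hy; rewrite (nr_sub hx (hs _)); lra.
Qed.

Lemma cvg_to_inp (s : nat -> vec E) x y : (forall n, mem (s n)) -> mem x -> mem y ->
  cvg_to s x -> cvgC (fun n => << s n, y >>) << x, y >>.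
Proof.
move=> hs hx hy /(cvg_toP hs hx) sx; apply/cvgCP => e e0.
have y0 := nr_ge0 hy.
have [|N hN] := sx (e / (nr y + 1)); first by rewrite divr_gt0 //; lra.
exists N => n /hN; rewrite ltr_pdivlMr; last by lra.
rewrite -inpBl //; have := cauchy_schwarz (memB hE (hs n) hx) hy.
have := nr_ge0 (memB hE (hs n) hx); nra.
Qed.

(** Over complex scalars a real quadratic form forces symmetry: polarise with [a^* *: y + x] at
    [a = 1] and [a = 'i], then add the two identities. *)
Lemma positive_selfadjoint (T : vec E -> vec E) x y : is_positive_op T ->
  mem x -> mem y -> << T x, y >> = << x, T y >>.
Proof.
move=> [[Tm Tlin _] Tp] hx hy.
have Tr z : mem z -> << T z, z >>^* = << T z, z >>.
  by move=> hz; apply: CrealP; apply: ger0_real; apply: Tp.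
have hTx := Tm _ hx; have hTy := Tm _ hy.
have key a : a^* * << T x, y >>^* + a * << T y, x >>^* = a * << T x, y >> + a^* * << T y, x >>.
  have := Tr _ (memZD hE a^* hy hx); rewrite Tlin // !inpDl ?inpZl ?inpDr ?inpZr //; try ms.
  rewrite !(rmorphD, rmorphM) /= (Tr x) // (Tr y) // !conjCK => h.
  by apply: subr0_eq; move/eqP: h; rewrite -subr_eq0 => /eqP <-; ring.
rewrite [RHS]inpC //; have := key 1; have := key 'i; rewrite conjCi rmorph1.
set p := << T x, y >>; set q := << T y, x >>^*; move=> h1 h2.
have h3 : - p^* + q = p - << T y, x >>.
  by apply: (mulfI (neq0Ci R[i])); apply: subr0_eq; rewrite -(subrr ('i * p + - 'i * << T y, x >>)) -{1}h1; ring.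
apply: (mulfI (_ : 2%:R != 0 :> R[i])); first by rewrite pnatr_eq0.
have -> : 2%:R * q = (1 * p^* + 1 * q) + (- p^* + q) by ring.
rewrite h2 h3; ring.
Qed.

End InnerProduct.

(** * Bounded operators: real bounds, linearity, continuity *)

Section BoundedOperators.
Variables (R : realType) (E F : space R).
Hypotheses (hE : is_inner_product_space E) (hF : is_inner_product_space F).
Variable T : vec E -> vec F.

Lemma bounded_op_intro (M : R) : (forall x, mem E x -> mem F (T x)) ->
  (forall a x y, mem E x -> mem E y -> T (a *: x + y) = a *: T x + T y) ->
  (forall x, mem E x -> nr (T x) <= M * nr x) -> is_bounded_op T.
Proof.
move=> Tm Tl TM; split=> //; exists M%:C => x hx.
rewrite (hnormE hE hx) (hnormE hF (Tm _ hx)).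
by rewrite -(rmorphM (real_complex R)) lecR TM.
Qed.

Hypothesis hT : is_bounded_op T.

Lemma bop_mem x : mem E x -> mem F (T x).
Proof. by case: hT => h _ _; apply: h. Qed.
Lemma bop_bound : exists2 M : R, 0 <= M & forall x, mem E x -> nr (T x) <= M * nr x.
Proof.
(* The given bound [M] is complex. Since [M * nr x] dominates a norm it is nonnegative, hence equal
   to its own modulus. *)
case: hT => Tm _ [M hM]; exists (normc M) => [|x hx]; first exact: normc_ge0.
have Tx0 := nr_ge0 hF (Tm _ hx).
have := hM _ hx; rewrite (hnormE hE hx) (hnormE hF (Tm _ hx)) => h.
have h0 : 0 <= M * (nr x)%:C by apply: le_trans h; rewrite lecR.
move: h; rewrite -(ger0_norm h0) normCE lecR normcM normc_real ger0_norm //.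
exact: nr_ge0.
Qed.
Lemma bopZD a x y : mem E x -> mem E y -> T (a *: x + y) = a *: T x + T y.
Proof. by case: hT => _ h _; apply: h. Qed.
Lemma bop0 : T 0 = 0.
Proof.
have := @bopZD 1 0 0; rewrite scaler0 addr0 scale1r => h.
by have /eqP := h ltac:(ms) ltac:(ms); rewrite eq_sym -subr_eq0 addrK => /eqP.
Qed.
Lemma bopD x y : mem E x -> mem E y -> T (x + y) = T x + T y.
Proof. by move=> hx hy; rewrite -{1}[x]scale1r bopZD // scale1r. Qed.
Lemma bopZ a x : mem E x -> T (a *: x) = a *: T x.
Proof. by move=> hx; rewrite -[a *: x]addr0 bopZD ?bop0 ?addr0 //; ms. Qed.
Lemma bopB x y : mem E x -> mem E y -> T (x - y) = T x - T y.
Proof. by move=> hx hy; rewrite bopD -?[- y]scaleN1r ?bopZ ?scaleN1r //; ms. Qed.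

Lemma bop_cvg s x : (forall n, mem E (s n)) -> mem E x -> cvg_to s x ->
  cvg_to (fun n => T (s n)) (T x).
Proof.
move=> hs hx /(cvg_toP hE hs hx) sx.
have [M M0 hM] := bop_bound.
apply/(cvg_toP hF) => [n||e e0]; [exact: bop_mem|exact: bop_mem|].
have [|N hN] := sx (e / (M + 1)); first by rewrite divr_gt0 //; lra.
exists N => n /hN; rewrite ltr_pdivlMr; last by lra.
have hd := memB hE (hs n) hx.
rewrite -bopB //; have := hM _ hd; have := nr_ge0 hE hd; nra.
Qed.

End BoundedOperators.

Lemma bop_comp (R : realType) (E F G : space R) (T : vec F -> vec G) (T' : vec E -> vec F) :
  is_inner_product_space E -> is_inner_product_space F -> is_inner_product_space G ->
  is_bounded_op T -> is_bounded_op T' -> is_bounded_op (fun x => T (T' x)).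
Proof.
move=> hE hF hG hT hT'.
have [M M0 hM] := bop_bound hF hG hT; have [M' M0' hM'] := bop_bound hE hF hT'.
apply: (bounded_op_intro hE hG (M := M * M')) => // [x hx|a x y hx hy|x hx].
- by apply: (bop_mem hT); apply: (bop_mem hT').
- by rewrite (bopZD hT') // (bopZD hT) //; apply: (bop_mem hT').
- apply: le_trans (hM _ _) _; first exact: (bop_mem hT').
  by rewrite -mulrA ler_wpM2l // hM'.
Qed.

(** * Riesz representation for a form bounded below on a closed subspace *)

(* A minimising sequence of [nr (J w) ^+ 2 - 2 Re (l w)] is Cauchy: at a point
   within [e ^+ 2] of the infimum the Euler-Lagrange residual is at most
   [e * nr (J h)] in each direction [h]. *)
Section CoerciveRiesz.
Variables (R : realType) (E F : space R).
Hypotheses (hE : is_hilbert E) (hF : is_inner_product_space F).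
Variables (M : vec E -> Prop) (J : vec E -> vec F) (l : vec E -> R[i]) (c L : R).
Hypotheses (hM : is_closed_subspace M) (hJ : is_bounded_op J) (c0 : 0 < c).
Hypothesis Jlow : forall x, M x -> c * nr x <= nr (J x).
Hypothesis llin : forall a x y, M x -> M y -> l (a *: x + y) = a * l x + l y.
Hypothesis lL : forall x, M x -> normc (l x) <= L * nr x.

Let hE1 : is_inner_product_space E := proj1 hE.
Let Mm x : M x -> mem E x. Proof. by case: hM => -[h _ _] _; apply: h. Qed.
Let MZD a x y : M x -> M y -> M (a *: x + y).
Proof. by case: hM => -[_ _ h] _; apply: h. Qed.
Let MB x y : M x -> M y -> M (x - y).
Proof. by move=> hx hy; rewrite addrC -scaleN1r; apply: MZD. Qed.
Let Jm x : M x -> mem F (J x). Proof. by move=> /Mm; apply: bop_mem. Qed.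

Let phi w := nr (J w) ^+ 2 - 2 * complex.Re (l w).
Let res w h := inp F (J h) (J w) - l h.

Let phi_expand w h t : M w -> M h ->
  phi (t *: h + w) = phi w + 2 * complex.Re (t * res w h) + normc t ^+ 2 * nr (J h) ^+ 2.
Proof.
move=> hw hh; rewrite /phi /res (bopZD hJ) ?llin //; try exact: Mm.
rewrite addrC [t *: _ + _]addrC nr_sqrDZ //; try exact: Jm.
rewrite mulrBr !cReD cReN; ring.
Qed.

Let phi_lb : exists b, forall w, M w -> b <= phi w.
Proof.
exists (- (L ^+ 2 / c ^+ 2)) => w hw.
have w0 := nr_ge0 hE1 (Mm hw); have h1 := Jlow hw; have h2 := lL hw.
have h3 := Re_le_normc (l w); rewrite /phi.
have h4 : (c * nr w) ^+ 2 <= nr (J w) ^+ 2.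
  by rewrite ler_pXn2r // ?nnegrE ?nr_ge0 ?mulr_ge0 ?(ltW c0) //; apply: Jm.
(* Completing the square in [c * nr w] produces the lower bound [- (L ^+ 2 / c ^+ 2)]. *)
have h5 : 0 <= (c * nr w - L / c) ^+ 2 by apply: sqr_ge0.
have h6 : (c * nr w - L / c) ^+ 2 = (c * nr w) ^+ 2 - 2 * (L * nr w) + L ^+ 2 / c ^+ 2.
  by field; rewrite gt_eqF.
lra.
Qed.

Let almost_min (e : R) : 0 < e -> exists2 w, M w & forall h, M h ->
  normc (res w h) <= e * nr (J h).
Proof.
move=> e0; have M0 : M 0 by case: hM => -[].
have [b hb] := phi_lb.
pose A := [set x : R | exists2 w, M w & x = phi w]%classic.
have hA : has_inf A by split; [exists (phi 0), 0 | exists b => _ [w hw ->]; apply: hb].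
have e2 : 0 < e ^+ 2 by rewrite exprn_gt0.
have [_ [w hw ->] hlt] := inf_adherent e2 hA.
exists w => // h hh; have Jh0 := nr_ge0 hF (Jm hh).
rewrite -(@ler_pXn2r _ 2) ?nnegrE ?normc_ge0 ?mulr_ge0 ?(ltW e0) // exprMn.
(* Moving from [w] by [t *: h] cannot lower [phi] below the infimum, that is, by more than [e ^+ 2].
   This is a nonnegative quadratic in [t] with constant term [e ^+ 2]. *)
apply: quad_disc => [|t]; first exact: sqr_ge0.
have : inf A <= phi (t *: h + w).
  by apply: ge_inf; [case: hA | exists (t *: h + w) => //; apply: MZD].
rewrite phi_expand //; lra.
Qed.

(** Both residuals are tested in the direction [x - y]: the terms in [l] cancel and their difference
    is [nr (J (x - y)) ^+ 2], from which one factor is divided out. *)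
Let near_min x y d e : M x -> M y -> 0 <= d -> 0 <= e ->
  (forall h, M h -> normc (res x h) <= d * nr (J h)) ->
  (forall h, M h -> normc (res y h) <= e * nr (J h)) -> c * nr (x - y) <= d + e.
Proof.
move=> hx hy d0 e0 hd he; have hxy := MB hx hy; apply: le_trans (Jlow hxy) _.
have J0 := nr_ge0 hF (Jm hxy).
have [Jp|Jn] := ltP 0 (nr (J (x - y))); last by lra.
have : normc (res x (x - y) - res y (x - y)) = nr (J (x - y)) ^+ 2.
  rewrite /res; have -> (p q r : R[i]) : p - r - (q - r) = p - q by ring.
  rewrite -inpBr //; try exact: Jm; rewrite -(bopB hE1 hJ); try exact: Mm.
  by rewrite inp_self ?normc_real ?ger0_norm ?sqr_ge0 //; apply: Jm.
have := normc_add (res x (x - y)) (- res y (x - y)); rewrite normc_opp.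
have := hd _ hxy; have := he _ hxy => h1 h2 h3 h4.
rewrite -(ler_pM2r Jp) -expr2 -h4; lra.
Qed.

Lemma coercive_riesz : exists2 x, M x & forall h, M h -> inp F (J h) (J x) = l h.
Proof.
pose r (n : nat) : R := n.+1%:R^-1.
have r0 n : 0 < r n by rewrite invr_gt0 ltr0n.
have rle m n : (m <= n)%N -> r n <= r m by move=> ?; rewrite lef_pV2 ?posrE ?ltr0n // ler_nat.
have rsmall e : 0 < e -> exists N, r N < e.
  by move=> /ltr_add_invr[N]; rewrite add0r; exists N.
(* The factor [c] in the tolerance cancels the one in [near_min], leaving distances at most
   [r m + r n]. *)
have /choice[w hw] n : exists w, M w /\ forall h, M h -> normc (res w h) <= c * r n * nr (J h).
  by have [|w] := @almost_min (c * r n); [rewrite mulr_gt0 | exists w].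
have wM n : M (w n) by case: (hw n).
have wm n := Mm (wM n).
have wcauchy m n : nr (w m - w n) <= r m + r n.
  rewrite -(ler_pM2l c0) mulrDr; have [m0 n0] := (mulr_gt0 c0 (r0 m), mulr_gt0 c0 (r0 n)).
  by apply: near_min => //; rewrite ?ltW //; [case: (hw m) | case: (hw n)].
have [||x [xm wx]] := (proj2 hE) w => //.
  move=> e e0; have e1 : e = (complex.Re e)%:C.
    by rewrite [LHS]complexE ger0_Im ?ltW // mulr0 addr0.
  rewrite e1 ltcR in e0; have [|N hN] := rsmall (complex.Re e / 2); first by lra.
  exists N => m n Nm Nn; rewrite e1 hnormE ?ltcR //; last ms.
  have := wcauchy m n; have := rle _ _ Nm; have := rle _ _ Nn; lra.
have xM : M x by case: hM => _; apply; eauto.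
exists x => // h hh; apply/subr0_eq/eq0_normc/le_anti; rewrite normc_ge0 andbT.
apply: le0_of_lt_eps => e e0.
have [K K0 hK] := bop_bound hE1 hF hJ.
have c1 : 0 <= c := ltW c0.
have Jh0 := nr_ge0 hF (Jm hh).
(* The two error terms below are at most [c * e' * k] and [k * (K * e')]; this [e'] keeps their sum
   under [e], also when [k = 0]. *)
set k := nr (J h) in Jh0; pose e' := e / (2 * (k + 1) * (c + K + 1)).
have e'0 : 0 < e' by rewrite divr_gt0 // mulr_gt0 //; lra.
move/(cvg_toP hE1 wm xm): wx => /(_ _ e'0)[N1 hN1].
have [N2 hN2] := rsmall _ e'0.
have hn1 := hN1 _ (leq_maxl N1 N2); have hn2 := rle _ _ (leq_maxr N1 N2).
set n := maxn N1 N2 in hn1 hn2.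
have -> : inp F (J h) (J x) - l h = res (w n) h + inp F (J h) (J (x - w n)).
  rewrite (bopB hE1 hJ) // inpBr //; try exact: Jm; rewrite /res; ring.
apply: le_lt_trans (normc_add _ _) _.
have h1 : normc (res (w n) h) <= c * r n * k by case: (hw n) => _; apply.
have h2 := cauchy_schwarz hF (Jm hh) (Jm (MB xM (wM n))).
have h3 : nr (J (x - w n)) <= K * nr (x - w n) by apply: hK; ms.
have h3' : nr (J (x - w n)) <= K * e'.
  by apply: le_trans h3 _; rewrite ler_wpM2l // (nr_sub hE1) // ltW.
have h4 : k * nr (J (x - w n)) <= k * (K * e') by rewrite ler_wpM2l.
have h5 : c * r n * k <= c * e' * k by rewrite ler_wpM2r // ler_wpM2l ?ltW //; lra.
have h6 : e = e' * (2 * (k + 1) * (c + K + 1)) by rewrite mulfVK // gt_eqF // mulr_gt0 //; lra.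
have h7 : 0 < e' * (2 * (k + 1) * (c + K + 1)- c * k - k * K) by rewrite mulr_gt0 //; nra.
rewrite -/k in h2; lra.
Qed.

End CoerciveRiesz.

(** * Orthogonal projections and closed spans *)

Section Subspaces.
Variables (R : realType) (E : space R).
Hypothesis hE : is_hilbert E.
Let hE1 : is_inner_product_space E := proj1 hE.

Lemma orth_proj_ex (M : vec E -> Prop) : is_closed_subspace M ->
  forall f, mem E f -> exists p, is_orth_proj_pt M f p.
Proof.
move=> hM f hf; have Mm x : M x -> mem E x by case: hM => -[h _ _] _; apply: h.
have hid : is_bounded_op (@id (vec E)).
  by apply: (bounded_op_intro hE1 hE1 (M := 1)) => // x; rewrite mul1r.
(* With [J] the identity, the representative on [M] of the functional given by [f] is the projection
   of [f]. *)
have [||||p Mp hp] := @coercive_riesz _ E E hE hE1 M id (fun h => inp E h f) 1 (nr f) hM hid.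
- by [].
- by move=> x hx; rewrite mul1r.
- by move=> a x y hx hy; apply: inpZDl => //; apply: Mm.
- by move=> x /Mm hx; rewrite mulrC; apply: cauchy_schwarz.
exists p; split=> // w Mw; have [pm wm] := (Mm _ Mp, Mm _ Mw).
by rewrite inpBl // ![inp E _ w]inpC // hp // subrr.
Qed.

Lemma cspan_mem u j : (forall j, mem E (u j)) -> cspan u (u j).
Proof.
move=> um; split=> // e e0; exists j.+1, (fun i => (i == j)%:R).
rewrite big_ord_recr /= big1 => [|i _]; last by rewrite ltn_eqF ?scale0r.
by rewrite eqxx scale1r add0r subrr (hnormE hE1) ?(nr0 hE1) //; ms.
Qed.

Lemma cspanP u x : (forall j, mem E (u j)) -> mem E x -> cspan u x <->
  forall e : R, 0 < e -> exists n (a : nat -> R[i]), nr (x - \sum_(j < n) a j *: u j) < e.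
Proof.
move=> um xm; split=> [[_ h] e e0|h].
  have [|n [a]] := h e%:C; first by rewrite ltcR.
  by rewrite (hnormE hE1) ?ltcR; [exists n, a | apply/memB/mem_sum].
split=> // e e0; have e1 : e = (complex.Re e)%:C.
  by rewrite [LHS]complexE ger0_Im ?ltW // mulr0 addr0.
rewrite e1 ltcR in e0; have [n [a hn]] := h _ e0; exists n, a.
by rewrite e1 (hnormE hE1) ?ltcR //; apply/memB/mem_sum.
Qed.

(** Choosing one approximant per tolerance [k.+1%:R^-1] gives a sequence to which continuity of
    operators applies. *)
Lemma cspan_approx u x : (forall j, mem E (u j)) -> cspan u x ->
  exists n (a : nat -> nat -> R[i]), cvg_to (fun k => \sum_(j < n k) a k j *: u j) x.
Proof.
move=> um hx; have xm := proj1 hx.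
have /choice[n hn] k : exists n, exists a : nat -> R[i], nr (x - \sum_(j < n) a j *: u j) < k.+1%:R^-1.
  by apply: (proj1 (cspanP um xm)) => //; rewrite invr_gt0 ltr0n.
have /choice[a ha] := hn; exists n, a.
apply/(cvg_toP hE1) => // [k|e e0]; first by apply: mem_sum.
have /ltr_add_invr[N] := e0; rewrite add0r => hN; exists N => k Nk.
rewrite (nr_sub hE1) //; last by apply: mem_sum.
apply: lt_trans (ha k) (le_lt_trans _ hN).
by rewrite lef_pV2 ?posrE ?ltr0n // ler_nat.
Qed.

(** Padding with zero coefficients brings two finite combinations to a common length. *)
Lemma sum_widen (u : nat -> vec E) n m (a : nat -> R[i]) : (n <= m)%N ->
  \sum_(j < n) a j *: u j = \sum_(j < m) (if (j < n)%N then a j else 0) *: u j.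
Proof.
move=> nm; rewrite (big_ord_widen m (fun j => a j *: u j) nm) big_mkcond /=.
by apply: eq_bigr => i _; case: ifP => // _; rewrite scale0r.
Qed.

Lemma cspan_closed_subspace u : (forall j, mem E (u j)) -> is_closed_subspace (cspan u).
Proof.
move=> um; split; first split.
- by move=> x [].
- apply/(cspanP um) => [|e e0]; first ms.
  by exists 0%N, (fun=> 0); rewrite big_ord0 subrr nr0.
- move=> k x y hx hy; have [xm ym] := (proj1 hx, proj1 hy).
  apply/(cspanP um) => [|e e0]; first ms.
  have k0 := normc_ge0 k.
  move/(cspanP um xm): hx => /(_ (e / 2 / (normc k + 1))) [|n [a ha]].
    by rewrite !divr_gt0 //; lra.
  move/(cspanP um ym): hy => /(_ (e / 2)) [|m [b hb]]; first by lra.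
  pose a' j := if (j < n)%N then a j else 0; pose b' j := if (j < m)%N then b j else 0.
  rewrite (sum_widen u a (leq_maxl n m)) in ha.
  rewrite (sum_widen u b (leq_maxr n m)) in hb.
  exists (maxn n m), (fun j => k * a' j + b' j).
  have -> : \sum_(j < maxn n m) (k * a' j + b' j) *: u j =
     k *: (\sum_(j < maxn n m) a' j *: u j) + \sum_(j < maxn n m) b' j *: u j.
    rewrite scaler_sumr -big_split /=; apply: eq_bigr => i _.
    by rewrite scalerDl scalerA.
  have am : mem E (\sum_(j < maxn n m) a' j *: u j) by apply: mem_sum.
  have bm : mem E (\sum_(j < maxn n m) b' j *: u j) by apply: mem_sum.
  rewrite opprD addrACA -scalerBr; apply: le_lt_trans (nrD hE1 _ _) _; try ms.
  rewrite (nrZ hE1); last ms; move: ha; rewrite ltr_pdivlMr; last by lra.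
  have := nr_ge0 hE1 (memB hE1 xm am); nra.
- move=> s x hs xm.
  have sm n : mem E (s n) by case: (hs n).
  move=> /(cvg_toP hE1 sm xm) sx.
  apply/(cspanP um) => // e e0.
  have [|N /(_ _ (leqnn N)) hN] := sx (e / 2); first by lra.
  move/(cspanP um (sm N)): (hs N) => /(_ (e / 2)) [|n [a ha]]; first by lra.
  exists n, a; have := nrB_le hE1 xm (sm N) (mem_sum hE1 n a um).
  by rewrite (nr_sub hE1 xm (sm N)); lra.
Qed.

End Subspaces.

(** * Square-summable sequences as an inner product space *)

Section L2.
Variable R : realType.
Local Notation l2 := (@l2space R).
Implicit Types c d : nat -> R[i].

Lemma sum_sqr_norm c n : \sum_(j < n) `|c j| ^+ 2 = (\sum_(j < n) normc (c j) ^+ 2)%:C.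
Proof. by rewrite rmorph_sum; apply: eq_bigr => j _; rewrite rmorphXn. Qed.

Lemma is_l2P c : is_l2 c <-> exists b : R, forall n, \sum_(j < n) normc (c j) ^+ 2 <= b.
Proof.
split=> -[b hb].
  by exists (complex.Re b) => n; have := hb n; rewrite sum_sqr_norm lecE => /andP[].
by exists b%:C => n; rewrite sum_sqr_norm lecR.
Qed.

Lemma is_l2_0 : is_l2 (0 : nat -> R[i]).
Proof. by apply/is_l2P; exists 0 => n; rewrite big1 // => j _; rewrite normc0 expr0n. Qed.

Lemma is_l2_ZD a c d : is_l2 c -> is_l2 d -> is_l2 (a *: c + d).
Proof.
move=> /is_l2P[b hb] /is_l2P[b' hb']; apply/is_l2P.
exists (2 * normc a ^+ 2 * b + 2 * b') => n.
have h0 : 0 <= 2 * normc a ^+ 2 by rewrite mulr_ge0 ?sqr_ge0.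
apply: (@le_trans _ _ (2 * normc a ^+ 2 * (\sum_(j < n) normc (c j) ^+ 2)
    + 2 * (\sum_(j < n) normc (d j) ^+ 2))); last first.
  by have := hb' n; have := ler_wpM2l h0 (hb n); lra.
rewrite !mulr_sumr -big_split /=; apply: ler_sum => j _.
have -> : (a *: c + d) j = a * c j + d j by [].
have := normc_add (a * c j) (d j); rewrite normcM.
have := normc_ge0 (a * c j + d j); have := normc_ge0 (d j); have := normc_ge0 (c j).
have := normc_ge0 a; set x := normc _; set y := normc _; set z := normc _; set t := normc _.
move=> x0 y0 z0 t0 h; have xy : 0 <= x * y by rewrite mulr_ge0.
have : t ^+ 2 <= (x * y + z) ^+ 2 by rewrite ler_pXn2r // ?nnegrE; lra.
(* This square gives [(x * y + z) ^+ 2 <= 2 * (x * y) ^+ 2 + 2 * z ^+ 2]. *)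
have := sqr_ge0 (x * y - z); lra.
Qed.

Lemma l2_sqr_series c : is_l2 c -> exists2 r : R,
  cvgC (fun n => \sum_(j < n) c j * (c j)^*) r%:C &
  forall n, \sum_(j < n) normc (c j) ^+ 2 <= r.
Proof.
move=> /is_l2P[b hb].
have [|l [hl hn _]] := @nonneg_series_cvg _ (fun j => normc (c j) ^+ 2) _ _ hb.
  by move=> j; apply: sqr_ge0.
exists l => //; apply: cvgC_ext hl => n; rewrite rmorph_sum.
by apply: eq_bigr => j _; rewrite normc_sqrE.
Qed.

(* By polarisation, the series is a combination of four convergent series of nonnegative terms. *)
Lemma l2inp_cvg c d : is_l2 c -> is_l2 d ->
  cvgC (fun n => \sum_(j < n) c j * (d j)^*) (l2inp c d).
Proof.
move=> hc hd; apply: ClassicalEpsilon.epsilon_spec.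
have pol k : exists l, cvgC (fun n => \sum_(j < n) (k *: d + c) j * ((k *: d + c) j)^*) l.
  by have [r hr _] := l2_sqr_series (is_l2_ZD k hd hc); exists r%:C.
have [[l1 h1] [l2 h2] [l3 h3] [l4 h4]] := And4 (pol 1) (pol (-1)) (pol 'i) (pol (- 'i)).
have h := cvgC_lin (1 / 4%:R) h1 (cvgC_lin (- (1 / 4%:R)) h2 (cvgC_lin ('i / 4%:R) h3
  (cvgC_lin (- ('i / 4%:R)) h4 (cvgC_cst 0)))).
eexists; apply: cvgC_ext h => n; rewrite addr0 !mulr_sumr -!big_split /=.
apply: eq_bigr => j _.
have E k : (k *: d + c) j = k * d j + c j by [].
rewrite !E !rmorphD !rmorphM !rmorphN rmorph1 /= conjCi.
set x := c j; set y := d j; set x' := x^*; set y' := y^*.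
have i2 : 'i * 'i = -1 :> R[i] by rewrite -expr2 sqrCi.
have -> : 1 / 4 * ((1 * y + x) * (1 * y' + x')) + (- (1 / 4) * ((-1 * y + x) * (-1 * y' + x'))
  + ('i / 4 * (('i * y + x) * (- 'i * y' + x')) + - ('i / 4) * ((- 'i * y + x) * (- - 'i * y' + x'))))
  = (x * y' + x' * y) / 2 + ('i * 'i) * (x' * y - x * y') / 2 :> R[i] by field.
by rewrite i2; field.
Qed.

(** [l2inp] picks some limit by [epsilon]; as the series converges, uniqueness of limits identifies
    the pick with any limit exhibited. *)
Lemma l2inp_def c d a : is_l2 c -> is_l2 d ->
  cvgC (fun n => \sum_(j < n) c j * (d j)^*) a -> l2inp c d = a.
Proof. by move=> hc hd; apply: cvgC_uniq; apply: l2inp_cvg. Qed.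

Lemma l2_self c : is_l2 c -> exists2 r : R, l2inp c c = r%:C &
  forall n, \sum_(j < n) normc (c j) ^+ 2 <= r.
Proof.
by move=> hc; have [r hr hn] := l2_sqr_series hc; exists r => //; apply: l2inp_def.
Qed.

Lemma l2_inner_product : is_inner_product_space l2.
Proof.
split=> /=.
- exact: is_l2_0.
- by move=> a x y; apply: is_l2_ZD.
- move=> a x y z hx hy hz; apply: l2inp_def => //; first exact: is_l2_ZD.
  apply: cvgC_ext (cvgC_lin a (l2inp_cvg hx hz) (l2inp_cvg hy hz)) => n.
  rewrite mulr_sumr -big_split; apply: eq_bigr => j _ /=.
  have -> : (a *: x + y) j = a * x j + y j by []; ring.
- move=> x y hx hy; apply: l2inp_def => //.
  apply: cvgC_ext (cvgC_conj (l2inp_cvg hy hx)) => n; rewrite rmorph_sum.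
  by apply: eq_bigr => j _; rewrite rmorphM /= conjCK mulrC.
- move=> x hx; have [r -> hr] := l2_self hx; split.
    by have := hr 0%N; rewrite big_ord0 lecR.
  move=> /(congr1 (@complex.Re _)) /= r0; apply/funext => j; apply: eq0_normc.
  have := hr j.+1; rewrite big_ord_recr /= r0.
  have : 0 <= \sum_(i < j) normc (x i) ^+ 2 by apply: sumr_ge0 => i _; apply: sqr_ge0.
  have := sqr_ge0 (normc (x j)) => h1 h2 h3; apply/eqP; rewrite -sqrf_eq0; apply/eqP; lra.
Qed.

End L2.

(** * Analysis and synthesis operators of a frame sequence *)

Section FrameSequences.
Variables (R : realType) (V : lmodType R[i]) (ip : V -> V -> R[i]).
Local Notation H := (full_space ip).
Local Notation l2 := (@l2space R).
Hypothesis hH : is_hilbert H.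
Variables (u : nat -> vec H) (A B : R[i]) (Uop : vec l2 -> vec H).
Hypotheses (hu : is_frame_sequence u A B) (hUop : is_synthesis u Uop).

Let hH1 : is_inner_product_space H := proj1 hH.
Let hl2 : is_inner_product_space l2 := l2_inner_product R.
Let Usp := cspan u.
Let Us : vec H -> vec l2 := analysis u.
Let Uclosed : is_closed_subspace Usp. Proof. by apply: cspan_closed_subspace. Qed.

Lemma orth_proj_nr (M : vec H -> Prop) f p : is_orth_proj_pt M f p -> nr p <= nr f.
Proof.
move=> [Mp hp]; apply: (nr_le_of_inp hH1) => //.
have e : inp H f p = inp H p p by apply/subr0_eq; rewrite -inpBl //; apply: hp.
by rewrite [RHS](inpC hH1) // e -(inpC hH1).
Qed.

Lemma orth_proj_analysis f p : is_orth_proj_pt Usp f p -> Us f = Us p.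
Proof.
move=> [_ hp]; apply/funext => j; apply/subr0_eq; rewrite /Us /analysis -inpBl //.
by apply: hp; apply: cspan_mem.
Qed.

Lemma cspan_analysis f : Usp f -> [/\ is_l2 (Us f),
  complex.Re A * nr f ^+ 2 <= nr (Us f) ^+ 2 & nr (Us f) ^+ 2 <= complex.Re B * nr f ^+ 2].
Proof.
case: hu => _ A0 B0 /(_ f) h /h[s [hs [hA hB]]].
have hl : is_l2 (Us f).
  apply/is_l2P; move/cvgCP: hs => /(_ 1 ltr01)[N hN]; exists (normc s + 1) => n.
  (* The partial sums increase, and from index [N] on they lie within 1 of [s], so [normc s + 1]
     bounds them all. *)
  have le_max : \sum_(j < n) normc (Us f j) ^+ 2 <= \sum_(j < maxn n N) normc (Us f j) ^+ 2.
    rewrite (big_ord_widen _ (fun j => normc (Us f j) ^+ 2) (leq_maxl n N)).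
    rewrite [leRHS](bigID (fun i : 'I__ => (i < n)%N)) /= lerDl sumr_ge0 // => i _.
    exact: sqr_ge0.
  apply: le_trans le_max _; have := hN _ (leq_maxr n N).
  rewrite (sum_sqr_norm (Us f)); set x := \sum_(j < _) _ => hx.
  have h1 : x <= normc (x%:C - s + s) by rewrite subrK; apply: (Re_le_normc x%:C).
  have := normc_add (x%:C - s) s; lra.
have e : inp l2 (Us f) (Us f) = s.
  by apply: l2inp_def => //; apply: cvgC_ext hs => n; apply: eq_bigr => j _; rewrite normCK.
have real z : 0 < z -> z = (complex.Re z)%:C :> R[i].
  by move=> z0; rewrite [LHS]complexE ger0_Im ?ltW // mulr0 addr0.
move: hA hB; rewrite -e (real _ A0) (real _ B0) !inp_self // -!(rmorphM (real_complex R)).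
by rewrite !lecR.
Qed.

(** The frame inequality speaks only of the closed span. A general [f] is replaced by its
    projection, which has the same coefficients and no larger norm. *)
Lemma analysis_bop : is_bounded_op Us.
Proof.
have B0 : 0 < complex.Re B by case: hu => _ _; rewrite ltcE => /andP[].
have dec f : exists2 p, is_orth_proj_pt Usp f p & Us f = Us p.
  have [p hp] := orth_proj_ex hH Uclosed (f := f) I.
  by exists p => //; apply: orth_proj_analysis.
have bnd f : is_l2 (Us f) /\ nr (Us f) <= Num.sqrt (complex.Re B) * nr f.
  have [p hp ->] := dec f; have [hl _ hb] := cspan_analysis (proj1 hp); split=> //.
  have p0 : 0 <= nr p by apply: nr_ge0.
  apply: le_trans (_ : Num.sqrt (complex.Re B) * nr p <= _); last first.
    by rewrite ler_wpM2l ?sqrtr_ge0 //; apply: orth_proj_nr hp.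
  have n0 := nr_ge0 hl2 (x := Us p) hl.
  by rewrite -(@ler_pXn2r _ 2) ?nnegrE ?mulr_ge0 ?sqrtr_ge0 // exprMn sqr_sqrtr // ltW.
apply: (bounded_op_intro hH1 hl2 (M := Num.sqrt (complex.Re B))).
- by move=> f _; case: (bnd f).
- by move=> a x y _ _; apply/funext => j; rewrite /Us /analysis inpZDl.
- by move=> f _; case: (bnd f).
Qed.

Let Usl2 f : is_l2 (Us f). Proof. by apply: (bop_mem analysis_bop). Qed.

Lemma analysis_lower : exists2 c : R, 0 < c & forall f, Usp f -> c * nr f <= nr (Us f).
Proof.
have A0 : 0 < complex.Re A by case: hu => _; rewrite ltcE => /andP[].
exists (Num.sqrt (complex.Re A)); first by rewrite sqrtr_gt0.
move=> f /cspan_analysis[hl ha _].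
have [f0 n0] : 0 <= nr f /\ 0 <= nr (Us f) by split; apply: nr_ge0.
by rewrite -(@ler_pXn2r _ 2) ?nnegrE ?mulr_ge0 ?sqrtr_ge0 // exprMn sqr_sqrtr // ltW.
Qed.

Lemma cspan_analysis0 f : Usp f -> Us f = 0 -> f = 0.
Proof.
have [c c0 hc] := analysis_lower => /hc + e; rewrite e nr0 // pmulr_rle0 // => h.
by apply: (nr0_eq0 hH1) => //; apply/le_anti; rewrite h nr_ge0.
Qed.

Lemma synthesis_cspan c : is_l2 c -> Usp (Uop c).
Proof.
move=> /hUop h; split=> // e /h[N hN]; exists N, c.
rewrite hnormE // (nr_sub hH1) // -(hnormE hH1) //; exact: hN.
Qed.

Lemma synthesis_adjoint c f : is_l2 c -> inp H (Uop c) f = inp l2 c (Us f).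
Proof.
move=> hc; symmetry; apply: l2inp_def => //.
have := cvg_to_inp hH1 (y := f) _ _ _ (hUop hc) => /(_ (fun=> I) I I).
apply: cvgC_ext => n; rewrite inp_suml //; apply: eq_bigr => j _.
by rewrite [inp H (u j) f]inpC.
Qed.

(** Both linearity and the bound are read off from adjointness to the analysis operator, whose
    boundedness is known. *)
Lemma synthesis_bop : is_bounded_op Uop.
Proof.
have [b b0 hb] := bop_bound hH1 hl2 analysis_bop.
apply: (bounded_op_intro hl2 hH1 (M := b)) => //.
- move=> a x y hx hy; apply/subr0_eq/(inp_self0 hH1) => //; set d := (X in inp _ _ X).
  have hxy := is_l2_ZD a hx hy.
  rewrite inpBl // inpDl // inpZl // !synthesis_adjoint // inpZDl //; try exact: Usl2.
  by rewrite subrr.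
- move=> c hc; have [n0 c0] : 0 <= nr (Uop c) /\ 0 <= nr (c : vec l2) by split; apply: nr_ge0.
  (* From [nr (Uop c) ^+ 2 = <c, Us (Uop c)> <= nr c * b * nr (Uop c)] one factor is cancelled. *)
  have [np|] := ltP 0 (nr (Uop c)); last by have := mulr_ge0 b0 c0; lra.
  rewrite -(ler_pM2r np) -expr2.
  have : nr (Uop c) ^+ 2 = normc (inp l2 c (Us (Uop c))).
    by rewrite -synthesis_adjoint // inp_self // normc_real ger0_norm ?sqr_ge0.
  move=> ->; apply: le_trans (cauchy_schwarz hl2 hc (Usl2 _)) _.
  by rewrite [b * _]mulrC -mulrA ler_wpM2l // hb.
Qed.

Lemma synthesis_fin n (a : nat -> R[i]) : exists2 c, is_l2 c &
  Uop c = \sum_(j < n) a j *: u j.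
Proof.
pose c j := if (j < n)%N then a j else 0.
have cE m : (n <= m)%N -> \sum_(j < m) c j *: u j = \sum_(j < n) a j *: u j.
  by move=> nm; rewrite (sum_widen u a nm).
have hc : is_l2 c.
  apply/is_l2P; exists (\sum_(j < n) normc (a j) ^+ 2) => m.
  apply: le_trans (_ : \sum_(j < maxn m n) normc (c j) ^+ 2 <= _).
    rewrite (big_ord_widen _ (fun j => normc (c j) ^+ 2) (leq_maxl m n)).
    rewrite [leRHS](bigID (fun i : 'I__ => (i < m)%N)) /= lerDl sumr_ge0 // => i _.
    exact: sqr_ge0.
  rewrite (big_ord_widen _ (fun j => normc (a j) ^+ 2) (leq_maxr m n)) [leRHS]big_mkcond /=.
  apply: ler_sum => i _; rewrite /c; case: ifP => // _.
  by rewrite normc0 expr0n.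
exists c => //; apply: (cvg_to_uniq hH1 (s := fun n => \sum_(j < n) c j *: u j)) => //.
  exact: hUop.
apply/(cvg_toP hH1) => // e e0; exists n => m /cE ->.
by rewrite subrr nr0.
Qed.

(** The analysis of a finite combination lies in the range of [U^* U], where [S] is a right inverse.
    Continuity carries the identity to the closed span, and injectivity of [Us] there strips off the
    outer [Us]. *)
Lemma synthesis_pinv S : is_pseudoinverse (fun c => Us (Uop c)) S ->
  forall f, Usp f -> Uop (S (Us f)) = f.
Proof.
move=> [Sb _ _ hS] f hf.
have Ul : is_bounded_op (fun c => Us (Uop c)) := bop_comp hl2 hH1 hl2 analysis_bop synthesis_bop.
have SU : is_bounded_op (fun f => S (Us f)) := bop_comp hH1 hl2 hl2 Sb analysis_bop.
have Wb : is_bounded_op (fun f => Us (Uop (S (Us f)))) := bop_comp hH1 hl2 hl2 Ul SU.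
have Sl2 := bop_mem SU (x := f) I.
have fix1 : Us (Uop (S (Us f))) = Us f.
  have [n [a ha]] := cspan_approx hH (fun=> I) hf.
  have h1 := bop_cvg hH1 hl2 Wb (fun=> I) I ha.
  have h2 := bop_cvg hH1 hl2 analysis_bop (fun=> I) I ha.
  apply: (cvg_to_uniq hl2 _ _ _ h1) => [k| | |]; try exact: Usl2.
  set s := (fun k => _) in h2; set s' := (fun k => _); suff -> : s' = s by [].
  apply/funext => k; rewrite /s' /s; have [c hc <-] := synthesis_fin (n k) (a k).
  by apply: hS; exists c.
apply/subr0_eq/cspan_analysis0.
  rewrite addrC -scaleN1r; case: Uclosed => -[_ _ h] _; apply: h => //.
  exact: synthesis_cspan.
by rewrite (bopB hH1 analysis_bop) // fix1 subrr.
Qed.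

(** [K f] is the sequence of canonical dual coefficients. The last clause, orthogonality to the
    kernel of [Uop], makes it the preimage of least norm. *)
Lemma synthesis_right_inverse : exists K : vec H -> vec l2, [/\ is_bounded_op K,
  (forall f, Usp f -> Uop (K f) = f) &
  (forall f d, is_l2 d -> Uop d = 0 -> inp l2 (K f) d = 0)].
Proof.
have [c c0 hc] := analysis_lower.
(* [X] inverts the frame operator [Uop] after [Us] on the span; for general [f] it inverts at the
   projection of [f]. *)
have /choice[X hX] f : exists x, Usp x /\ forall h, Usp h -> inp l2 (Us h) (Us x) = inp H h f.
  have [||x] := @coercive_riesz _ H l2 hH hl2 Usp Us (fun h => inp H h f) c (nr f)
    Uclosed analysis_bop c0 hc.
  - by move=> a x y _ _; apply: inpZDl.
  - by move=> x _; rewrite mulrC; apply: cauchy_schwarz.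
  by exists x.
(* An element of [Us (Usp)] is determined by its pairings with that subspace; linearity of [K]
   follows from this. *)
have Uinj x y : Usp x -> Usp y -> (forall h, Usp h -> inp l2 (Us h) (Us x) = inp l2 (Us h) (Us y)) ->
    Us x = Us y.
  move=> hx hy h; apply/subr0_eq/(inp_self0 hl2); first by apply: (memB hl2); apply: Usl2.
  have hxy : Usp (x - y).
    by rewrite addrC -scaleN1r; case: Uclosed => -[_ _ k] _; apply: k.
  rewrite -{1}(bopB hH1 analysis_bop (x := x) (y := y) I I) (inpBr hl2); try exact: Usl2.
  by rewrite h // subrr.
exists (fun f => Us (X f)); split.
- apply: (bounded_op_intro hH1 hl2 (M := c^-1)) => [f _|a f g _ _|f _].
  + exact: Usl2.
  + rewrite -(bopZD analysis_bop) //; apply: Uinj.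
    * by case: (hX (a *: f + g)).
    * by case: Uclosed => -[_ _ k] _; apply: k; [case: (hX f) | case: (hX g)].
    * move=> h hh; rewrite (bopZD analysis_bop) // inpDr ?inpZr //; try exact: Usl2.
        by rewrite !(proj2 (hX _)) // inpDr // inpZr.
      by apply: memZ => //; apply: Usl2.
  (* Testing with [h = X f] gives [nr (Us (X f)) ^+ 2 <= nr (X f) * nr f], and
     [nr (X f) <= c^-1 * nr (Us (X f))]. *)
  + have [hx /(_ _ hx) hself] := hX f; have n0 := nr_ge0 hl2 (Usl2 (X f)).
    have f0 : 0 <= nr f by apply: nr_ge0.
    have [np|] := ltP 0 (nr (Us (X f))); last first.
      by have : 0 <= c^-1 * nr f; [rewrite mulr_ge0 // invr_ge0 ltW | lra].
    have := cauchy_schwarz hH1 (x := X f) (y := f) I I.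
    rewrite -hself inp_self ?normc_real ?ger0_norm ?sqr_ge0 //; try exact: Usl2.
    have := hc _ hx; rewrite -ler_pdivlMl // => h1 h2.
    rewrite -(ler_pM2r np) -expr2; apply: le_trans h2 _.
    by rewrite mulrAC ler_wpM2r.
- move=> f hf; have [hx hxf] := hX f; apply/subr0_eq/(inp_self0 hH1) => //.
  set d := (X in inp _ X X); have hd : Usp d.
    rewrite /d addrC -scaleN1r; case: Uclosed => -[_ _ k] _; apply: k => //.
    by apply: synthesis_cspan; apply: Usl2.
  rewrite {1}/d inpBl // synthesis_adjoint //; try exact: Usl2.
  rewrite (inpC hl2) ?hxf //; try exact: Usl2.
  by rewrite -(inpC hH1) // subrr.
- move=> f d hd Ud; rewrite (inpC hl2) //; try exact: Usl2.
  by rewrite -synthesis_adjoint // Ud inp0l // rmorph0.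
Qed.

End FrameSequences.

(** [T] after [Td] is continuous and fixes the range pointwise, so it fixes every limit of points of
    the range. *)
Lemma pseudoinverse_closed_range (R : realType) (E F : space R)
    (T : vec E -> vec F) (Td : vec F -> vec E) :
  is_inner_product_space E -> is_inner_product_space F ->
  is_bounded_op T -> is_pseudoinverse T Td -> has_closed_range T.
Proof.
move=> hE hF hT [hTd _ _ TTd] s x hs hx sx.
have sm n : mem F (s n) by have [c [hc ->]] := hs n; apply: (bop_mem hT).
have Tx := bop_mem hTd hx; exists (Td x); split=> //.
apply: (cvg_to_uniq hF sm hx (bop_mem hT Tx) sx).
have := bop_cvg hF hF (bop_comp hF hE hF hT hTd) sm hx sx.
by congr (cvg_to _ _); apply/funext => n; apply: TTd.
Qed.

(** * Oblique projection and least squares for an operator bounded below on a span *)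

Section LeastSquares.
Variables (R : realType) (V : lmodType R[i]) (ip : V -> V -> R[i]).
Local Notation H := (full_space ip).
Local Notation l2 := (@l2space R).
Hypothesis hH : is_hilbert H.
Variables (g : nat -> vec H) (C D : R[i]) (Gop : vec l2 -> vec H).
Hypotheses (hg : is_frame_sequence g C D) (hGop : is_synthesis g Gop).
Variables (Q : vec H -> vec l2) (Qs : vec l2 -> vec H) (c : R).
Hypotheses (Qb : is_bounded_op Q) (Qsb : is_bounded_op Qs).
Hypothesis QQs : forall h y, is_l2 y -> inp l2 (Q h) y = inp l2 (Q h) (Q (Qs y)).
Hypotheses (c0 : 0 < c) (Qlow : forall h, cspan g h -> c * nr h <= nr (Q h)).

Let hH1 : is_inner_product_space H := proj1 hH.
Let hl2 : is_inner_product_space l2 := l2_inner_product R.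
Let Gsp := cspan g.
Let Gclosed : is_closed_subspace Gsp. Proof. by apply: cspan_closed_subspace. Qed.
Let Gb : is_bounded_op Gop. Proof. exact: synthesis_bop hg hGop. Qed.
Let GG d : is_l2 d -> Gsp (Gop d). Proof. exact: synthesis_cspan. Qed.
Let GZD a x y : Gsp x -> Gsp y -> Gsp (a *: x + y).
Proof. by case: Gclosed => -[_ _ k] _; apply: k. Qed.
Let GB x y : Gsp x -> Gsp y -> Gsp (x - y).
Proof. by move=> hx hy; rewrite addrC -scaleN1r; apply: GZD. Qed.
Let Ql2 f : is_l2 (Q f). Proof. by apply: (bop_mem Qb). Qed.
Let Qm f : mem l2 (Q f). Proof. exact: Ql2. Qed.

(** Becomes [P_U(G)^perp] once [<Q h, Q f>] is known to be [<P_U h, f>]. *)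
Definition Qperp (f : vec H) := forall h, Gsp h -> inp l2 (Q h) (Q f) = 0.
Definition lsq_op (d : vec l2) : vec l2 := Q (Gop d).
Local Notation T := lsq_op.

Lemma lsq_bop : is_bounded_op T. Proof. exact: bop_comp Qb Gb. Qed.

Lemma Q_inj x y : Gsp x -> Gsp y -> Q x = Q y -> x = y.
Proof.
move=> hx hy e; apply/subr0_eq/(nr0_eq0 hH1) => //.
have := Qlow (GB hx hy); rewrite (bopB hH1 Qb) // e subrr nr0 // pmulr_rle0 // => h.
by apply/le_anti; rewrite h nr_ge0.
Qed.

Lemma Qperp_eq x y : Gsp x -> Gsp y -> Qperp (x - y) -> x = y.
Proof.
move=> hx hy h; apply: Q_inj => //; apply/subr0_eq/(inp_self0 hl2).
  by apply: (memB hl2); apply: Ql2.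
by rewrite -(bopB hH1 Qb) //; apply: h; apply: GB.
Qed.

Lemma QperpB f x : Qperp (f - x) <->
  forall h, Gsp h -> inp l2 (Q h) (Q x) = inp l2 (Q h) (Q f).
Proof.
split=> k h hh.
  apply/esym/subr0_eq; rewrite -inpBr //; try exact: Ql2.
  by rewrite -(bopB hH1 Qb) //; apply: k.
by rewrite (bopB hH1 Qb) // inpBr ?k ?subrr //; apply: Ql2.
Qed.

(** [Q (P f)] is the orthogonal projection of [Q f] onto [Q(G)], found by the Riesz theorem with
    [J = Q]. Linearity follows from uniqueness of such a point. *)
Lemma oblique_proj_ex : exists P : vec H -> vec H,
  [/\ is_bounded_op P, forall f, Gsp (P f) & forall f, Qperp (f - P f)].
Proof.
have [M M0 hM] := bop_bound hH1 hl2 Qb.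
have /choice[P hP] f : exists x, Gsp x /\ Qperp (f - x).
  have [||x hx hxf] := @coercive_riesz _ H l2 hH hl2 Gsp Q (fun h => inp l2 (Q h) (Q f)) c
    (M * nr (Q f)) Gclosed Qb c0 Qlow.
  - by move=> a x y _ _; rewrite (bopZD Qb) // (inpZDl hl2) //; apply: Ql2.
  - move=> h _; apply: le_trans (cauchy_schwarz hl2 (Ql2 _) (Ql2 _)) _.
    by rewrite mulrAC ler_wpM2r ?hM //; apply: (nr_ge0 hl2 (Ql2 f)).
  by exists x; split=> //; apply/QperpB.
have PG f : Gsp (P f) by case: (hP f).
have PQ f : Qperp (f - P f) by case: (hP f).
exists P; split=> //; apply: (bounded_op_intro hH1 hH1 (M := c^-1 * M)) => // [a x y _ _|f _].
  have hxy := GZD a (PG x) (PG y).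
  apply: Qperp_eq => //; apply/QperpB => h hh.
  rewrite ((QperpB _ _).1 (PQ (a *: x + y))) // !(bopZD Qb) //.
  rewrite !(inpDr hl2) ?(inpZr hl2) ?((QperpB _ _).1 (PQ _) _ hh) //; try exact: Ql2.
  - by apply: (memZ hl2); apply: Ql2.
  - by apply: (memZ hl2); apply: Ql2.
(* The chain is [c * nr (P f) <= nr (Q (P f)) <= nr (Q f) <= M * nr f]. *)
rewrite -mulrA -ler_pdivrMl ?invr_gt0 // invrK; apply: le_trans (Qlow (PG f)) _.
apply: le_trans (hM f I); apply: (nr_le_of_inp hl2); try exact: Ql2.
exact: ((QperpB _ _).1 (PQ f)).
Qed.

Variable P : vec H -> vec H.
Hypotheses (Pb : is_bounded_op P) (PG : forall f, Gsp (P f)).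
Hypothesis PQ : forall f, Qperp (f - P f).

Lemma oblique_proj_uniq f x : Gsp x -> Qperp (f - x) -> P f = x.
Proof.
move=> hx h; apply: Qperp_eq => //; apply/QperpB => k hk.
by rewrite ((QperpB f (P f)).1 (PQ f)) // ((QperpB f x).1 h).
Qed.

Lemma oblique_proj_id x : Gsp x -> P x = x.
Proof.
by move=> hx; apply: oblique_proj_uniq => // h _; rewrite subrr (bop0 hH1 Qb) (inp0r hl2 (Ql2 h)).
Qed.

Lemma oblique_proj0 f : P f = 0 <-> Qperp f.
Proof.
split=> [e|h]; first by have := PQ f; rewrite e subr0.
by apply: oblique_proj_uniq; [case: Gclosed => -[] | rewrite subr0].
Qed.

Lemma oblique_projP : is_oblique_proj Gsp Qperp P.
Proof.
split=> //.
- by move=> x _; apply: oblique_proj_id.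
- move=> y; split=> [[x [_ ->]] //|hy]; exists y; split=> //.
  by rewrite oblique_proj_id.
- move=> x; split=> [[_ /oblique_proj0]|/oblique_proj0] //.
Qed.

(** [P] depends on [f] only through pairings of [Q f] with [Q(G)], and by [QQs] these do not change
    when [Q f] becomes [Q (Qs (Q f))]. *)
Lemma oblique_proj_Qs f : P (Qs (Q f)) = P f.
Proof.
apply: oblique_proj_uniq => //; apply/QperpB => h hh.
by rewrite -QQs // ((QperpB f (P f)).1 (PQ f)).
Qed.

Variable K : vec H -> vec l2.
Hypotheses (Kb : is_bounded_op K) (GK : forall f, Gsp f -> Gop (K f) = f).
Hypothesis Kperp : forall f d, is_l2 d -> Gop d = 0 -> inp l2 (K f) d = 0.

Let Kl2 f : is_l2 (K f). Proof. by apply: (bop_mem Kb). Qed.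
Let Km f : mem l2 (K f). Proof. exact: Kl2. Qed.

Lemma lsq_kernel d : kernel T d <-> is_l2 d /\ Gop d = 0.
Proof.
split=> -[hd e]; split=> //; last by rewrite /lsq_op e (bop0 hH1 Qb).
by apply: Q_inj; rewrite ?(bop0 hH1 Qb) //; [exact: GG | case: Gclosed => -[]].
Qed.

Lemma lsq_range y : range T y <-> exists2 h, Gsp h & y = Q h.
Proof.
split=> [[d [hd ->]]|[h hh ->]]; first by exists (Gop d) => //; apply: GG.
by exists (K h); split; [exact: Kl2 | rewrite /lsq_op GK].
Qed.

Lemma perp_kernel_synthesis d : perp (kernel T) d -> K (Gop d) = d.
Proof.
move=> [hd hp]; apply/esym/subr0_eq/(inp_self0 hl2); first by apply: (memB hl2).
(* The difference [e] lies in the kernel while both its terms are orthogonal to the kernel, so [e]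
   is orthogonal to itself. *)
set e := (X in inp _ X X); have he : is_l2 e by apply: (memB hl2).
have Ge : Gop e = 0 by rewrite (bopB hl2 Gb) // GK ?subrr //; apply: GG.
rewrite {1}/e inpBl // Kperp // hp ?subrr //.
by apply/lsq_kernel.
Qed.

(** [K] is injective on the span, so the kernel is where [P (Qs y) = 0], which by [QQs] means that
    [y] is orthogonal to [Q(G)], the range of [T]. *)
Lemma lsq_pseudoinverse : is_pseudoinverse T (fun y => K (P (Qs y))).
Proof.
split.
- exact: bop_comp Kb (bop_comp hl2 hH1 hH1 Pb Qsb).
- move=> y; split=> [[hy e]|[hy hp]]; split=> //.
    move=> _ /lsq_range[h hh ->].
    have {}e : P (Qs y) = 0 by rewrite -(GK (PG (Qs y))) e (bop0 hl2 Gb).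
    move/oblique_proj0: e => /(_ h hh); rewrite -QQs // => k.
    by rewrite (inpC hl2) // k rmorph0.
  suff -> : P (Qs y) = 0 by rewrite (bop0 hH1 Kb).
  apply/oblique_proj0 => h hh; rewrite -QQs // (inpC hl2) // hp ?rmorph0 //.
  by apply/lsq_range; exists h.
- move=> x; split=> [[y [hy ->]]|hx].
    by split=> [|d /lsq_kernel[hd Gd]]; [exact: Kl2 | apply: Kperp].
  (* A vector orthogonal to the kernel is recovered from its own image under [T]. *)
  exists (T x); split; first by apply: Ql2.
  rewrite /lsq_op oblique_proj_Qs oblique_proj_id; last by apply: GG; case: hx.
  by rewrite perp_kernel_synthesis.
- by move=> _ /lsq_range[h hh ->]; rewrite oblique_proj_Qs oblique_proj_id // /T GK.
Qed.

(** [Td] kills [Q (f - P f)], which is orthogonal to the range of [T], and inverts [T] at [Q (P f)];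
    injectivity of [Q] on the span then gives the equality. *)
Lemma pseudoinverse_oblique Td : is_pseudoinverse T Td -> forall f, Gop (Td (Q f)) = P f.
Proof.
move=> [Tdb Tdker _ TTd] f.
have rPf : range T (Q (P f)) by apply/lsq_range; exists (P f).
have -> : Td (Q f) = Td (Q (P f)).
  apply/subr0_eq; rewrite -(bopB hl2 Tdb) // -(bopB hH1 Qb) //.
  suff /Tdker[] : perp (range T) (Q (f - P f)) by [].
  split=> [|_ /lsq_range[h hh ->]]; first exact: Ql2.
  by rewrite (inpC hl2) // PQ // rmorph0.
have hl := bop_mem Tdb (Ql2 (P f)).
by apply: Q_inj => //; [exact: GG | exact: TTd].
Qed.

Lemma lsq_pythagoras f d : is_l2 d ->
  nr (Q f - T d) ^+ 2 = nr (Q f - Q (P f)) ^+ 2 + nr (Q (P f) - T d) ^+ 2.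
Proof.
move=> hd; have hG := GG hd.
have -> : Q f - T d = (Q f - Q (P f)) + (Q (P f) - T d) by rewrite addrA subrK.
rewrite /lsq_op -!(bopB hH1 Qb) // (nr_sqrD hl2) //; try exact: Ql2.
rewrite (inpC hl2) ?(PQ f (GB (PG f) hG)) ?rmorph0 ?mulr0 ?addr0 //; exact: Ql2.
Qed.

(** In the Pythagorean splitting only the second term depends on [d]. It vanishes at [K (P f)],
    hence at every minimiser. *)
Lemma lsq_min f d : is_l2 d ->
  (forall d' : vec l2, is_l2 d' -> hnorm (Q f - T d) <= hnorm (Q f - T d')) <-> Gop d = P f.
Proof.
move=> hd; have TP : T (K (P f)) = Q (P f) by rewrite /lsq_op GK.
have hn d' : is_l2 d' -> hnorm (Q f - T d') = (nr (Q f - T d'))%:C.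
  by move=> hd'; apply: hnormE => //; apply: (memB hl2); apply: Ql2.
have n0 d' : 0 <= nr (Q f - T d') by apply: (nr_ge0 hl2); apply: (memB hl2); apply: Ql2.
split=> [h|e d' hd'].
  have := h _ (Kl2 (P f)); rewrite !hn // lecR -(@ler_pXn2r _ 2) ?nnegrE // lsq_pythagoras //.
  rewrite TP gerDl => h1; apply/esym/Q_inj => //; first exact: GG.
  apply/subr0_eq/(nr0_eq0 hl2); first by apply: (memB hl2); apply: Ql2.
  by apply/eqP; rewrite -sqrf_eq0; apply/eqP/le_anti; rewrite h1 sqr_ge0.
rewrite !hn // lecR -(@ler_pXn2r _ 2) ?nnegrE // [leRHS]lsq_pythagoras //.
by rewrite /lsq_op e lerDl sqr_ge0.
Qed.

(** Any other minimiser differs from [K (P f)] by an element of the kernel of [Gop], to which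
    [K (P f)] is orthogonal. *)
Lemma lsq_min_norm f : is_min_norm_lsq T (Q f) (K (P f)).
Proof.
split; [exact: Kl2 | by apply/lsq_min; rewrite ?GK |].
move=> d hd /(lsq_min _ hd) e; rewrite !(hnormE hl2) // lecR.
have [n1 n2] : 0 <= nr (K (P f)) /\ 0 <= nr d by split; apply: (nr_ge0 hl2).
rewrite -(@ler_pXn2r _ 2) ?nnegrE //.
have hdk : is_l2 (d - K (P f)) by apply: (memB hl2).
have -> : d = K (P f) + (d - K (P f)) by rewrite addrC subrK.
have Gdk : Gop (d - K (P f)) = 0 by rewrite (bopB hl2 Gb) // GK // e subrr.
by rewrite (nr_sqrD hl2 (Km (P f)) hdk) (Kperp (P f) hdk Gdk) mulr0 addr0 lerDl sqr_ge0.
Qed.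

End LeastSquares.

(** * The operator [Q] as a partial isometry *)

Section AnalysisSqrt.
Variables (R : realType) (V : lmodType R[i]) (ip : V -> V -> R[i]).
Local Notation H := (full_space ip).
Local Notation l2 := (@l2space R).
Hypothesis hH : is_hilbert H.
Variables (u : nat -> vec H) (A B : R[i]) (Uop : vec l2 -> vec H).
Hypotheses (hu : is_frame_sequence u A B) (hUop : is_synthesis u Uop).
Variables S Rt : vec l2 -> vec l2.
Hypothesis hS : is_pseudoinverse (fun c => analysis u (Uop c)) S.
Hypotheses (hRt : is_positive_op Rt) (hRtS : forall c, is_l2 c -> Rt (Rt c) = S c).

Let hH1 : is_inner_product_space H := proj1 hH.
Let hl2 : is_inner_product_space l2 := l2_inner_product R.
Let Ub : is_bounded_op (analysis u) := analysis_bop hH hu.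
Let Rb : is_bounded_op Rt := proj1 hRt.
Let Q f := Rt (analysis u f).

Lemma sqrt_analysis_bop : is_bounded_op Q.
Proof. exact: bop_comp Rb Ub. Qed.

(* [Q] is a partial isometry: its Gram form is that of the projection onto the span of [u]. *)
Lemma inp_sqrt_analysis f p h : is_orth_proj_pt (cspan u) f p ->
  inp l2 (Q f) (Q h) = inp H p h.
Proof.
move=> hp; have al2 x : is_l2 (analysis u x) by apply: (bop_mem Ub).
have rl2 x : is_l2 x -> is_l2 (Rt x) by apply: (bop_mem Rb).
rewrite /Q (orth_proj_analysis hH hp) -(positive_selfadjoint hl2 hRt (rl2 _ (al2 p)) (al2 h)).
rewrite hRtS // -(synthesis_adjoint hH hu hUop); last by rewrite -hRtS //; exact: (rl2 _ (rl2 _ (al2 p))).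
by rewrite (synthesis_pinv hH hu hUop hS) //; case: hp.
Qed.

(** [Uop] after [Rt] is the adjoint of [Q]. Its values lie in the span of [u], so each is its own
    projection in the Gram identity. *)
Lemma sqrt_analysis_adjoint h y : is_l2 y ->
  inp l2 (Q h) y = inp l2 (Q h) (Q (Uop (Rt y))).
Proof.
move=> hy; have al2 x : is_l2 (analysis u x) by apply: (bop_mem Ub).
have ry : is_l2 (Rt y) by apply: (bop_mem Rb).
have Ql2 f : is_l2 (Q f) by apply: (bop_mem sqrt_analysis_bop).
rewrite [RHS](inpC hl2 (Ql2 h) (Ql2 _)) (inp_sqrt_analysis (p := Uop (Rt y))); last first.
  by split=> [|w _]; [exact: synthesis_cspan | rewrite subrr inp0l].
rewrite (synthesis_adjoint hH hu hUop _ ry) -(inpC hl2 (al2 h) ry).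
by rewrite /Q (positive_selfadjoint hl2 hRt (al2 h) hy).
Qed.

Lemma nr_sqrt_analysis f p : is_orth_proj_pt (cspan u) f p -> nr (Q f) = nr p.
Proof.
move=> hp; have Ql2 : is_l2 (Q f) by apply: (bop_mem sqrt_analysis_bop).
have e : inp H f p = inp H p p.
  by apply/subr0_eq; rewrite -inpBl //; case: hp => [h1 h2]; apply: h2.
have [n1 n2] : 0 <= nr (Q f) /\ 0 <= nr p by split; apply: nr_ge0.
apply/eqP; rewrite -(@eqrXn2 _ 2) // -(Re_inp_self hl2) // -(Re_inp_self hH1) //.
by rewrite (inp_sqrt_analysis _ hp) (inpC hH1) // e -(inpC hH1).
Qed.

Lemma sqrt_analysis_lower (M : vec H -> Prop) : is_subspace M -> cos_angle_pos M (cspan u) ->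
  exists2 c : R, 0 < c & forall h, M h -> c * nr h <= nr (Q h).
Proof.
move=> [_ M0 MZD] [c [c0 hc]].
have cE : c = (complex.Re c)%:C by rewrite [LHS]complexE ger0_Im ?ltW // mulr0 addr0.
rewrite cE ltcR in c0; exists (complex.Re c) => // h hh.
have Uclosed : is_closed_subspace (cspan u) by apply: cspan_closed_subspace.
have [p hp] := orth_proj_ex hH Uclosed (f := h) I; rewrite (nr_sqrt_analysis hp).
have [h0 p0] : 0 <= nr h /\ 0 <= nr p by split; apply: nr_ge0.
have [hpos|] := ltP 0 (nr h); last by move=> hn; have -> : nr h = 0; [lra | rewrite mulr0].
(* The angle condition concerns unit vectors only, so [h] and its projection are rescaled
   together. *)
pose k : R[i] := ((nr h)^-1)%:C.
have kn x : nr (k *: x : vec H) = (nr h)^-1 * nr x.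
  by rewrite (nrZ hH1) // normc_real ger0_norm // invr_ge0.
have := hc (k *: h) (k *: p); rewrite !(hnormE hH1) // !kn mulVf ?gt_eqF // cE lecR.
rewrite [_^-1 * _]mulrC ler_pdivlMr //; apply.
- by rewrite -[k *: h]addr0; apply: MZD.
- by [].
- case: hp => p1 p2; split; first by rewrite -[k *: p]addr0; case: Uclosed => -[_ U0 UZ] _; apply: UZ.
  by move=> w hw; rewrite -scalerBr (inpZl hH1) // p2 // mulr0.
Qed.

End AnalysisSqrt.

(** * Specialisation of the least-squares results to the partial isometry [Q] *)

Theorem theorem2p4 (R : realType) (V : lmodType R[i]) (ip : V -> V -> R[i])
  (hH : is_hilbert (full_space ip)) (hsep : is_separable (full_space ip))
  (u g : nat -> vec (full_space ip)) (A B C D : R[i])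
  (hu : is_frame_sequence u A B) (hg : is_frame_sequence g C D)
  (Uop Gop : vec (@l2space R) -> vec (full_space ip))
  (hUop : is_synthesis u Uop) (hGop : is_synthesis g Gop)
  (* S = (U^* U)^dagger and Rt = (U^* U)^{dagger/2} *)
  (S Rt : vec (@l2space R) -> vec (@l2space R))
  (hS : is_pseudoinverse (fun c => analysis u (Uop c)) S)
  (hRt : is_positive_op Rt /\ (forall c, is_l2 c -> Rt (Rt c) = S c)) :
  let Us := analysis u in
  let Usp := cspan u in
  let Gsp := cspan g in
  (* P_U(G)^perp *)
  let W := perp [eta (fun p => exists h, Gsp h /\ is_orth_proj_pt Usp h p)] in
  let T := fun c => Rt (Us (Gop c)) in
  cos_angle_pos Gsp Usp ->
  [/\ (forall x, Gsp x -> W x -> x = 0),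
      (forall f : vec (full_space ip), exists x y, Gsp x /\ W y /\ f = x + y),
      has_closed_range T,
      (exists Td, is_pseudoinverse T Td) &
      exists P, is_oblique_proj Gsp W P /\
        (forall Td, is_pseudoinverse T Td ->
           forall f, Gop (Td (Rt (Us f))) = P f) /\
        (forall f, (exists c, is_min_norm_lsq T (Rt (Us f)) c) /\
           forall c, is_min_norm_lsq T (Rt (Us f)) c -> P f = Gop c)].
Proof.
move=> Us Usp Gsp W T hcos; case: hRt => Rp RS.
have hH1 := proj1 hH; have hl2 := l2_inner_product R.
pose Q f := Rt (Us f); pose Qs y := Uop (Rt y).
have Qb : is_bounded_op Q by apply: (sqrt_analysis_bop hH hu Rp).
have Qsb : is_bounded_op Qs by apply: (bop_comp hl2 hl2 hH1 (synthesis_bop hH hu hUop) (proj1 Rp)).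
have QQs h y : is_l2 y -> inp (@l2space R) (Q h) y = inp (@l2space R) (Q h) (Q (Qs y)).
  exact: (sqrt_analysis_adjoint hH hu hUop hS Rp RS).
have Uclosed : is_closed_subspace Usp by apply: cspan_closed_subspace.
have Gclosed : is_closed_subspace Gsp by apply: cspan_closed_subspace.
have [c c0 Qlow] := sqrt_analysis_lower hH hu hUop hS Rp RS (proj1 Gclosed) hcos.
(* For [p] the projection of [h], the Gram identity reads [<Q h, Q y> = <p, y>], so the two
   orthogonality conditions on [y] agree. *)
have WE : W = Qperp g Q.
  apply/funext => y; apply/propext; split=> [[_ hy] h hh|hy].
    have [p hp] := orth_proj_ex hH Uclosed (f := h) I.
    rewrite (inp_sqrt_analysis hH hu hUop hS Rp RS y hp) (inpC hH1) // hy ?rmorph0 //.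
    by exists h.
  split=> // p [h [hh hp]].
  by rewrite (inpC hH1) // -(inp_sqrt_analysis hH hu hUop hS Rp RS y hp) hy // rmorph0.
have [P [Pb PG PQ]] := oblique_proj_ex hH Qb c0 Qlow.
have [K [Kb GK Kperp]] := synthesis_right_inverse hH hg hGop.
have Tb : is_bounded_op T := lsq_bop hH hg hGop Qb.
(* This explicit pseudoinverse also supplies the closed range. *)
have hTd := lsq_pseudoinverse hH hg hGop Qb Qsb QQs c0 Qlow Pb PG PQ Kb GK Kperp.
rewrite {}WE; split.
- move=> x hx hW; apply: (Qperp_eq hH Qb c0 Qlow) => //; last by rewrite subr0.
  by case: Gclosed => -[].
- move=> f; exists (P f), (f - P f); split; first exact: PG.
  by split; [exact: PQ | rewrite addrC subrK].
- exact: (pseudoinverse_closed_range hl2 hl2 Tb hTd).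
- by eexists; exact: hTd.
exists P; split; first exact: (oblique_projP hH Qb c0 Qlow Pb PG PQ).
split=> [Td hT f|f]; first exact: (pseudoinverse_oblique hH hGop Qb c0 Qlow PG PQ Kb GK hT f).
split=> [|d [hd hmin _]].
  exists (K (P f)); exact: (lsq_min_norm hH hg hGop Qb c0 Qlow PG PQ Kb GK Kperp f).
exact: (esym ((lsq_min hH hGop Qb c0 Qlow PG PQ Kb GK f hd).1 hmin)).
Qed.
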